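(* For positive integers $l\le m\le n$, $$\Big\lceil\frac{lm+ln+mn}{2(l+m+n)-2}\Big\rceil \le \theta(K_{l,m,n}\times K_2)\le 2\,\theta(K_{m,n}).$$
   Context: The thickness $\theta(G)$ of a graph $G$ is the minimum number of planar subgraphs whose union is $G$. The Kronecker product $G\times H$ of graphs $G$ and $H$ is the graph with vertex set $V(G)\times V(H)$ in which $(g,h)$ and $(g',h')$ are adjacent if and only if $gg'\in E(G)$ and $hh'\in E(H)$. $K_{l,m,n}$ denotes the complete tripartite graph with parts of sizes $l,m,n$, and $K_{m,n}$ the complete bipartite graph with parts of sizes $m,n$. *)

(* Defs.v *)
From Stdlib Require Import Reals ClassicalEpsilon Arith.

Record graph := Graph { vtx : Type; adj : vtx -> vtx -> Prop }.

Definition fin (k : nat) : Type := {i : nat | (i < k)%nat}.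

Definition plane_drawing (G : graph) (pos : vtx G -> R * R)
    (arc : vtx G -> vtx G -> R -> R * R) : Prop :=
  (forall u v, pos u = pos v -> u = v) /\
  (forall u v, adj G u v ->
     (forall t, (0 <= t <= 1)%R ->
        continuity_pt (fun s => fst (arc u v s)) t /\
        continuity_pt (fun s => snd (arc u v s)) t) /\
     (forall s t, (0 <= s <= 1)%R -> (0 <= t <= 1)%R -> arc u v s = arc u v t -> s = t) /\
     arc u v 0%R = pos u /\ arc u v 1%R = pos v /\
     (forall t, (0 <= t <= 1)%R -> arc v u t = arc u v (1 - t)%R) /\
     (forall t w, (0 < t < 1)%R -> arc u v t <> pos w)) /\
  (forall u v u' v', adj G u v -> adj G u' v' ->
     ~ (u = u' /\ v = v') -> ~ (u = v' /\ v = u') ->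
     forall s t, (0 < s < 1)%R -> (0 <= t <= 1)%R -> arc u v s <> arc u' v' t).

Definition planar (G : graph) : Prop :=
  exists pos arc, plane_drawing G pos arc.

(* G is the union of k planar (spanning) subgraphs: an edge colouring c with
   k colours such that each colour class is planar. *)
Definition decomposable (G : graph) (k : nat) : Prop :=
  exists c : vtx G -> vtx G -> nat,
    (forall u v, adj G u v -> (c u v < k)%nat /\ c u v = c v u) /\
    (forall i, (i < k)%nat ->
       planar (Graph (vtx G) (fun u v => adj G u v /\ c u v = i))).

Definition is_thickness (G : graph) (t : nat) : Prop :=
  decomposable G t /\ forall k, decomposable G k -> (t <= k)%nat.

Definition thickness (G : graph) : nat :=
  epsilon (inhabits 0%nat) (is_thickness G).

Definition kron (G H : graph) : graph :=
  Graph (vtx G * vtx H)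
        (fun x y => adj G (fst x) (fst y) /\ adj H (snd x) (snd y)).

Definition K2 : graph := Graph bool (fun a b => a <> b).

Definition part3 {l m n : nat} (x : (fin l + fin m) + fin n) : nat :=
  match x with inl (inl _) => 0 | inl (inr _) => 1 | inr _ => 2 end%nat.

Definition K3part (l m n : nat) : graph :=
  Graph ((fin l + fin m) + fin n)%type (fun x y => part3 x <> part3 y).

Definition part2 {m n : nat} (x : fin m + fin n) : nat :=
  match x with inl _ => 0 | inr _ => 1 end%nat.

Definition K2part (m n : nat) : graph :=
  Graph (fin m + fin n)%type (fun x y => part2 x <> part2 y).

(* Main.v *)
(* Lower bound: the product with K2 is bipartite with 2(l+m+n) vertices and
   2(lm+ln+mn) edges, so it suffices that a planar bipartite graph on N >= 3
   vertices has at most 2N-4 edges.  To get this for arbitrary continuous arcs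
   without the Jordan curve theorem, sample each arc on a fine grid.  The first
   and last thirds of the arcs give pairwise disjoint connected blocks of lattice
   points, one per vertex, and the middle thirds give lattice paths between
   blocks, disjoint outside them.  On the grid every mod 2 cycle is the boundary
   of a set of unit squares; hence the boundaries of the faces (the classes of
   squares under crossing edges that belong neither to a path nor to a block)
   span the cycle space of the graph.  They sum to zero, each edge is on at most
   two of them, and each nonzero one has at least four edges because the graph is
   simple and bipartite: this gives E - V + 2 <= #faces <= E/2.

   Upper bound: the six complete bipartite pieces of the product form a hexagon
   X0 Y1 Z0 X1 Y0 Z1.  Each of its two perfect matchings is a disjoint union of
   three subgraphs of K_{m,n}, which can be drawn side by side. *)
Require Import Defs.
From Stdlib Require Import Reals ClassicalEpsilon Arith.
From Stdlib Require Import ZArith Lia.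
From Stdlib Require Lra.
From HB Require structures.
From mathcomp Require all_boot all_algebra zify.
From Coquelicot Require Rcomplements Compactness.

Module Grid.
Import HB.structures all_boot all_algebra zify.
Set Implicit Arguments.
Unset Strict Implicit.
Unset Printing Implicit Defensive.
Import GRing.Theory.
Local Open Scope ring_scope.

(** * Counting faces in a cycle space *)

(* Mod 2 arithmetic takes place in [bool], on which [+] is exclusive or. *)
Lemma bool_addrr (b : bool) : b + b = 0.
Proof. by case: b. Qed.

Section FaceCount.
Variables V1 V2 : finType.
Implicit Types (E : {set V1 * V2}) (z : V1 * V2 -> bool).

Definition even_on E z : Prop :=
  (forall a, \sum_(e in E | e.1 == a) z e = 0) /\
  (forall b, \sum_(e in E | e.2 == b) z e = 0).

Lemma even_second E z (P : pred (V1 * V2)) e0 :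
  \sum_(e in E | P e) z e = 0 -> e0 \in E -> P e0 -> z e0 ->
  exists2 e1, e1 != e0 & [/\ e1 \in E, P e1 & z e1].
Proof.
move=> s0 eE Pe ze; case: (pickP [pred e | [&& e != e0, e \in E, P e & z e]]).
  by move=> e /and4P[ne eE' Pe' ze']; exists e.
(* Without a second nonzero term the mod 2 sum would equal [z e0], which is 1. *)
move=> no; move: s0; rewrite (bigD1 e0) ?eE //= big1 ?addr0 ?ze // => e.
move=> /andP[/andP[eE' Pe'] ne]; apply/negbTE/negP=> ze'.
by have := no e; rewrite /= ne eE' Pe' ze'.
Qed.

(** Evenness at the two ends of [(a, b)] gives edges [(a, b')] and [(a', b)], and evenness at [b']
    gives [(a2, b')]. The four are distinct even when [a2 = a'], because [b' != b]. *)
Lemma even_card_ge4 E z e0 :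
  even_on E z -> e0 \in E -> z e0 -> (4 <= #|[set e in E | z e]|)%N.
Proof.
case: e0 => a b [ev1 ev2] e0E ze0.
have [[a1 b'] n1 [e1E /eqP /= ea z1]] := even_second (ev1 a) e0E (eqxx _) ze0.
subst a1; have nb : b' != b by apply: contraNneq n1 => ->.
have [[a' b1] n2 [e2E /eqP /= eb z2]] := even_second (ev2 b) e0E (eqxx _) ze0.
subst b1; have na : a' != a by apply: contraNneq n2 => ->.
have [[a2 b1] n3 [e3E /eqP /= eb z3]] := even_second (ev2 b') e1E (eqxx _) z1.
subst b1; have na2 : a2 != a by apply: contraNneq n3 => ->.
pose s := [:: (a, b); (a, b'); (a', b); (a2, b')].
have us : uniq s.
  rewrite /= !inE !negb_or !xpair_eqE !eqxx /= !andbT.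
  rewrite !(eq_sym a) (eq_sym b) (negPf nb) (negPf na) (negPf na2) /=.
  by rewrite ?andbF ?andFb.
rewrite -[4%N]/(size s) -(card_uniqP us); apply/subset_leq_card/subsetP=> e.
by rewrite !inE => /or4P[] /eqP->; apply/andP.
Qed.
End FaceCount.

(* Rank-nullity: if the [D f] span the left kernel of the incidence matrix and sum
   to zero, their number is at least #E - #V + 2 (unless all of them vanish). *)
Lemma cycle_rank (K : fieldType) (W V F : finType) (E : {set W})
    (inc : W -> V -> K) (D : F -> W -> K) :
  (0 < #|V|)%N ->
  (forall e, e \in E -> \sum_v inc e v = 0) ->
  (forall e, e \in E -> \sum_f D f e = 0) ->
  (forall z : W -> K, (forall v, \sum_(e in E) z e * inc e v = 0) ->
     exists s : F -> K, forall e, e \in E -> z e = \sum_f s f * D f e) ->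
  (#|E|.+1 < #|V| + maxn 1 #|[set f | [exists e in E, D f e != 0%R]]|)%N.
Proof.
move=> V_gt0 inc0 sum0 span; set F' := [set _ | _].
pose M : 'M[K]_(#|E|, #|V|) := \matrix_(i, j) inc (enum_val i) (enum_val j).
pose DM : 'M[K]_(#|F'|, #|E|) := \matrix_(i, j) D (enum_val i) (enum_val j).
have one1 n : (0 < n)%N -> \rank (const_mx 1 : 'rV[K]_n) = 1%N.
  move=> n0; apply/eqP; rewrite eqn_leq rank_leq_row lt0n mxrank_eq0.
  apply/eqP=> /matrixP/(_ 0 (Ordinal n0)); rewrite !mxE => /eqP.
  by rewrite oner_eq0.
(* Each row of [M] sums to zero, so the all-ones column lies in the right kernel. *)
have rM : (\rank M < #|V|)%N.
  have: M *m (const_mx 1 : 'rV[K]_#|V|)^T = 0.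
    apply/matrixP=> i j; rewrite !mxE -[RHS](inc0 (enum_val i)) ?enum_valP //.
    under eq_bigr do rewrite !mxE mulr1.
    by rewrite -(big_enum_val (fun v => inc (enum_val i) v)).
  by move/mulmx0_rank_max; rewrite mxrank_tr one1 // addn1.
have DF f e : e \in E -> f \notin F' -> D f e = 0.
  move=> eE nf; apply/eqP; apply: contraNT nf => Df.
  by rewrite inE; apply/exists_inP; exists e.
have kerD : (kermx M <= DM)%MS.
  apply/rV_subP=> z /sub_kermxP zM.
  (* The row vector [z] is extended by 0 outside [E], so that [span] applies to it. *)
  pose zf (e : W) := if @idP (e \in E) is ReflectT eE
     then z 0 (enum_rank_in eE e) else 0.
  have zfE (i : 'I_#|E|) : zf (enum_val i) = z 0 i.
    rewrite /zf; case: {-}_ / idP => [eE|]; last by case; exact: enum_valP.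
    by rewrite enum_valK_in.
  have incM v : \sum_(e in E) zf e * inc e v = 0.
    have /matrixP/(_ 0 (enum_rank v)) := zM; rewrite !mxE => zv.
    apply: etrans zv; rewrite big_enum_val /=.
    by apply: eq_bigr => i _; rewrite mxE enum_rankK zfE.
  have [s zs] := span zf incM.
  suff -> : z = (\row_i s (enum_val i)) *m DM by exact: submxMl.
  apply/matrixP=> i j; rewrite ord1 -zfE zs ?enum_valP // !mxE.
  rewrite (bigID [in F']) /= [X in _ + X]big1 ?addr0 => [|f nf].
    by rewrite big_enum_val; apply: eq_bigr => k _; rewrite !mxE.
  by rewrite DF ?mulr0 // enum_valP.
have rD : (0 < #|F'|)%N -> (\rank DM < #|F'|)%N.
  move=> F0; have: (const_mx 1 : 'rV[K]_#|F'|) *m DM = 0.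
    apply/matrixP=> i j; rewrite !mxE -[RHS](sum0 (enum_val j)) ?enum_valP //.
    rewrite [RHS](bigID [in F']) /= [X in _ = _ + X]big1 ?addr0 => [|f nf].
      by rewrite [RHS]big_enum_val; apply: eq_bigr => k _; rewrite !mxE mul1r.
    by rewrite DF // enum_valP.
  by move/mulmx0_rank_max; rewrite one1.
(* The kernel has dimension [#|E| - \rank M], at least [#|E| - #|V| + 1], and lies in a row space of
   rank at most [maxn 1 #|F'| - 1]. *)
have := mxrankS kerD; rewrite mxrank_ker.
have := rank_leq_row DM.
by case: (posnP #|F'|) => [F0|/rD]; lia.
Qed.

Lemma face_count (V1 V2 F : finType) (E : {set V1 * V2})
    (D : F -> V1 * V2 -> bool) :
  (forall e, e \in E -> #|[set f | D f e]| <= 2)%N ->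
  (forall e, e \in E -> \sum_f D f e = 0) ->
  (forall f, even_on E (D f)) ->
  (forall z, even_on E z -> exists s : F -> bool,
      forall e, e \in E -> z e = \sum_f s f * D f e) ->
  (2 < #|V1| + #|V2|)%N -> (#|E| <= 2 * (#|V1| + #|V2|) - 4)%N.
Proof.
move=> two sum0 evenD span V_gt2.
pose inc (e : V1 * V2) (v : V1 + V2) : bool :=
  match v with inl a => e.1 == a | inr b => e.2 == b end.
pose F' := [set f | [exists e in E, D f e]].
have rk : (#|E|.+1 < #|V1| + #|V2| + maxn 1 #|F'|)%N.
  have -> : F' = [set f | [exists e in E, D f e != 0]].
    by apply/setP=> f; rewrite !inE; apply: eq_existsb => e; case: (D f e).
  rewrite -card_sum; apply: (cycle_rank (inc := inc)) => [|e eE||z zM].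
  - by rewrite card_sum; lia.
  - rewrite big_sumType /= (bigD1 e.1) //= eqxx big1 ?addr0; last first.
      by move=> a /negbTE; rewrite eq_sym.
    rewrite (bigD1 e.2) //= eqxx big1 ?addr0 ?bool_addrr // => a /negbTE.
    by rewrite eq_sym.
  - exact: sum0.
  - apply: span; split=> [a|b].
      rewrite -[RHS](zM (inl a)) big_mkcondr; apply: eq_bigr => e _ /=.
      by case: (_ == _); case: (z e).
    rewrite -[RHS](zM (inr b)) big_mkcondr; apply: eq_bigr => e _ /=.
    by case: (_ == _); case: (z e).
(* Double counting of the incidences between edges and faces. *)
have four : (4 * #|F'| <= 2 * #|E|)%N.
  apply: (@leq_trans (\sum_(f in F') #|[set e in E | D f e]|)%N).
    rewrite mulnC -sum_nat_const; apply: leq_sum => f.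
    rewrite inE => /exists_inP[e eE De]; exact: even_card_ge4 (evenD f) eE De.
  rewrite mulnC -sum_nat_const.
  have swap (f : F) : #|[set e in E | D f e]| = (\sum_(e in E) D f e)%N.
    by rewrite -sum1_card big_mkcond [RHS]big_mkcond /=;
       apply: eq_bigr => e _; rewrite inE; case: (_ \in _); case: (D f e).
  under eq_bigr do rewrite swap.
  rewrite exchange_big; apply: leq_sum => e eE.
  apply: leq_trans (two e eE).
  rewrite -sum1_card [X in (_ <= X)%N]big_mkcond [X in (X <= _)%N]big_mkcond /=.
  by apply: leq_sum => f _; rewrite [f \in [set _ | _]]inE; case: (f \in F'); case: (D f e).
(* If [F'] is empty, [rk] gives at most N - 1 edges on N vertices, and N - 1 <= 2N - 4 since N >= 3.
   Otherwise [rk] and [four] combine. *)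
by lia.
Qed.

(** * Mod 2 chains on a discrete torus *)

Section Bool.
Lemma bool_add_eq0 (a b : bool) : (a + b = 0) <-> (a = b).
Proof. by case: a; case: b. Qed.

Lemma bool_add_or (a b : bool) : (a + b)%R -> a || b.
Proof. by case: a; case: b. Qed.

Lemma sum_pred1_mul (T : finType) (z : T) (f : T -> bool) :
  \sum_y (y == z) * f y = f z.
Proof.
rewrite (bigD1 z) //= eqxx mul1r big1 ?addr0 // => y /negbTE->.
by rewrite mul0r.
Qed.

(** Off the diagonal the terms cancel in pairs; the order by [enum_rank] selects one term from each
    pair. *)
Lemma sum_sym_square (T : finType) (c : T -> T -> bool) (B : {set T}) :
  (forall x y, c x y = c y x) -> (forall x, c x x = 0) ->
  \sum_(x in B) \sum_(y in B) c x y = 0.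
Proof.
move=> csym c0.
pose lt (x y : T) := (enum_rank x < enum_rank y)%N.
have split_c x y : c x y = (lt x y) * c x y + (lt y x) * c y x.
  rewrite (csym y x) -mulrDl /lt; case: (ltngtP (enum_rank x) (enum_rank y)) => h.
  - by rewrite addr0 mul1r.
  - by rewrite add0r mul1r.
  - by rewrite addr0 mul0r; move/val_inj/enum_rank_inj: h => ->.
under eq_bigr do under eq_bigr do rewrite split_c.
under eq_bigr do rewrite big_split /=.
rewrite big_split /= [X in _ + X]exchange_big /=; exact: bool_addrr.
Qed.

(** Summing the node condition over [B] counts each edge inside [B] twice and leaves the edges of
    the cut. *)
Lemma cut_sum (T : finType) (c : T -> T -> bool) (B : {set T}) :
  (forall x y, c x y = c y x) -> (forall x, c x x = 0) ->
  (forall x, \sum_y c x y = 0) ->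
  \sum_(x in B) \sum_(y | y \notin B) c x y = 0.
Proof.
move=> csym c0 node; have: \sum_(x in B) \sum_y c x y = 0 by apply: big1.
under eq_bigr do rewrite (bigID [in B]) /=.
by rewrite big_split /= sum_sym_square ?add0r.
Qed.
End Bool.

Section Torus.
Variable n : nat.
(** On a torus translations are group operations, so boundaries need no special case at a border.
    Side at least 3 keeps the four neighbours of a point distinct. The homology of the torus is
    avoided by keeping all cycles off the two axes. *)
Definition torus := ('I_n.+3 * 'I_n.+3)%type.
HB.instance Definition _ := GRing.Zmodule.on torus.
HB.instance Definition _ := Finite.on torus.
Implicit Types (x y q f : torus) (A S : torus -> bool).

Definition e1 : torus := (1, 0).
Definition e2 : torus := (0, 1).

Lemma sub_e1 (i j : 'I_n.+3) : (i, j) - e1 = (i - 1, j) :> torus.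
Proof. by congr pair; rewrite /= subr0. Qed.

Lemma sub_e2 (i j : 'I_n.+3) : (i, j) - e2 = (i, j - 1) :> torus.
Proof. by congr pair; rewrite /= subr0. Qed.

Definition adjacent x y :=
  [|| y == x + e1, x == y + e1, y == x + e2 | x == y + e2].

Lemma adjacent_sym x y : adjacent x y = adjacent y x.
Proof.
rewrite /adjacent; case: (y == x + e1); case: (x == y + e1);
by case: (y == x + e2); case: (x == y + e2).
Qed.

(* The point [q] names the unit square with lower left corner [q]; [bd A] is the
   mod 2 boundary of the set [A] of squares. *)
Definition bd A x y : bool :=
  (y == x + e1) * (A x + A (x - e2)) + (x == y + e1) * (A y + A (y - e2)) +
  ((y == x + e2) * (A x + A (x - e1)) + (x == y + e2) * (A y + A (y - e1))).

Lemma bd_sym A x y : bd A x y = bd A y x.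
Proof. by rewrite /bd; congr (_ + _); rewrite addrC. Qed.

Lemma bd_diag A x : bd A x x = 0.
Proof. by rewrite /bd !bool_addrr. Qed.

(** Each of the four squares around [x] has exactly two of its sides at [x]. *)
Lemma bd_node A x : \sum_y bd A x y = 0.
Proof.
have sw (e y : torus) (g : torus -> bool) :
    (x == y + e) * g y = (y == x - e) * g (x - e).
  by rewrite -subr_eq eq_sym; case: eqP => [->|] //; rewrite !mul0r.
under eq_bigr do rewrite /bd (sw e1 _ (fun y => A y + A (y - e2)))
   (sw e2 _ (fun y => A y + A (y - e1))).
rewrite !big_split /= !sum_pred1_mul (addrAC x (- e2) (- e1)).
by case: (A x); case: (A (x - e1)); case: (A (x - e2)); case: (A (x - e1 - e2)).
Qed.

Lemma addr_eq_self x z : (x == x + z) = (z == 0).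
Proof. by rewrite -{1}[x]addr0 (inj_eq (addrI x)) eq_sym. Qed.

Lemma step_neq x :
  ((x == x + e1 + e1) = false) * ((x + e1 == x + e2) = false) *
  ((x == x + e1 + e2) = false) * ((x == x + e2 + e1) = false) *
  ((x == x + e2 + e2) = false) * ((x + e2 == x + e1) = false).
Proof.
by do !split; rewrite -?addrA ?addr_eq_self ?(inj_eq (addrI x)).
Qed.

Lemma bd_e1 A x : bd A x (x + e1) = A x + A (x - e2).
Proof.
by rewrite /bd eqxx !step_neq !mul0r mul1r !addr0.
Qed.

Lemma bd_e2 A x : bd A x (x + e2) = A x + A (x - e1).
Proof.
by rewrite /bd eqxx !step_neq !mul0r mul1r !addr0 add0r.
Qed.

Variant adjacent_spec x : torus -> Prop :=
  | AdjE1 : adjacent_spec x (x + e1)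
  | AdjE2 : adjacent_spec x (x + e2)
  | AdjNE1 y of x = y + e1 : adjacent_spec x y
  | AdjNE2 y of x = y + e2 : adjacent_spec x y.

Lemma adjacentP x y : adjacent x y -> adjacent_spec x y.
Proof.
by case/or4P=> /eqP h; [rewrite h; apply: AdjE1 | apply: AdjNE1 | rewrite h; apply: AdjE2
  | apply: AdjNE2].
Qed.

(** * Cycles off the axes are boundaries *)

Section CycleBoundary.
Variable c : torus -> torus -> bool.
Hypothesis c_sym : forall x y, c x y = c y x.
Hypothesis c_adj : forall x y, c x y -> adjacent x y.
Hypothesis c_node : forall x, \sum_y c x y = 0.
Hypothesis c_off : forall x y, c x y -> (x.1 != 0) && (x.2 != 0).

Let h x := c x (x + e1).
Let v x := c x (x + e2).

Lemma node_sum x : h x + h (x - e1) + (v x + v (x - e2)) = 0.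
Proof.
rewrite -[RHS](c_node x).
have four y : c x y = (y == x + e1) * c x y + (y == x - e1) * c x y +
   ((y == x + e2) * c x y + (y == x - e2) * c x y).
  have sw (e : torus) : (y == x - e) = (x == y + e) by rewrite eq_sym subr_eq.
  rewrite !sw; case: (boolP (c x y)) => [/c_adj cxy|_]; last by rewrite !mulr0.
  by case/adjacentP: cxy => [||z ->|z ->]; rewrite ?step_neq ?eqxx.
under eq_bigr do rewrite four.
rewrite !big_split /= !sum_pred1_mul /h /v !subrK.
by rewrite (c_sym (x - e1)) (c_sym (x - e2)).
Qed.

(** The parity of the number of edges of [c] crossed by the vertical ray from square [(i, k)] down
    to row 0: the usual test for being enclosed by [c]. *)
Let s (i : 'I_n.+3) (k : nat) := \sum_(l < k.+1) h (i, l%:R).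

Lemma h_off i j : (i == 0) || (j == 0) -> h (i, j) = 0.
Proof.
by move=> ij; apply/negbTE/negP=> /c_off /=; rewrite -negb_or ij.
Qed.

Lemma natrS_sub1 k : k.+1%:R - 1 = k%:R :> 'I_n.+3.
Proof. by rewrite mulrSr addrK. Qed.

(** Induction upwards: the node condition at [(i, k + 1)] carries the identity from row [k] to the
    next one. In row 0 all the terms vanish because [c] avoids the axis. *)
Lemma s_col i k : s i k + s (i - 1) k = v (i, k%:R).
Proof.
elim: k => [|k IH].
  rewrite /s !big_ord1 !h_off ?eqxx ?orbT // addr0; apply/esym/negbTE/negP.
  by move=> /c_off /andP[_ /eqP]; case.
rewrite /s big_ord_recr [X in _ + X]big_ord_recr /= addrACA IH.
have := node_sum (i, k.+1%:R).
rewrite sub_e1 sub_e2 natrS_sub1.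
case: (h _); case: (h _); case: (v _); case: (v _) => //.
Qed.

(** Full column sums agree for neighbouring columns, as no vertical edge of [c] joins the top row to
    row 0, and column 0 carries no edge. This makes the ray test consistent across row 0. *)
Lemma s_top i : s i n.+2 = 0.
Proof.
have v0 j : v (j, n.+2%:R) = 0.
  apply/negbTE/negP; rewrite /v c_sym => /c_off /= /andP[_ /eqP[]].
  by rewrite -mulrSr Zp_nat; apply: val_inj; rewrite /= modnn.
rewrite -(natr_Zp i); elim: (nat_of_ord i) => [|k IH].
  by rewrite /s big1 // => l _; apply: h_off; rewrite eqxx.
have := s_col k.+1%:R n.+2; rewrite v0.
by rewrite natrS_sub1 IH addr0.
Qed.

Lemma cycle_boundary : exists S, forall x y, c x y = bd S x y.
Proof.
pose S x := s x.1 x.2; exists S.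
have SE i j : S (i, j) = s i j by [].
have Sh x : bd S x (x + e1) = c x (x + e1).
  rewrite bd_e1; case: x => i j; rewrite sub_e2 !SE -/(h (i, j)).
  (* Below row 0 lies the top row of squares, where [s_top] gives 0. *)
  case E: (nat_of_ord j) => [|k].
    have j0 : j = 0 by apply: val_inj.
    have -> : j - 1 = n.+2%:R.
      rewrite j0 -natrS_sub1 Zp_nat; congr (_ - _).
      by apply: val_inj; rewrite /= modnn.
    have -> : nat_of_ord (n.+2%:R : 'I_n.+3) = n.+2 by rewrite Zp_nat /= modn_small.
    rewrite s_top addr0 /s big_ord1; congr (h (_, _)); exact/esym.
  have jk : j = k.+1%:R by rewrite -E natr_Zp.
  have -> : nat_of_ord (j - 1) = k.
    rewrite jk natrS_sub1 Zp_nat /= modn_small //.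
    by have := ltn_ord j; lia.
  rewrite {1}/s big_ord_recr /= -/(s i k) jk.
  by case: (s i k); case: (h _).
have Sv x : bd S x (x + e2) = c x (x + e2).
  by rewrite bd_e2; case: x => i j; rewrite sub_e1 !SE s_col natr_Zp.
move=> x y; case: (boolP (adjacent x y)) => [/adjacentP[||z ->|z ->]|na].
- by rewrite Sh.
- by rewrite Sv.
- by rewrite c_sym bd_sym Sh.
- by rewrite c_sym bd_sym Sv.
have -> : c x y = false by apply: contraNF na; apply: c_adj.
move: na; rewrite /adjacent /bd !negb_or => /and4P[/negbTE-> /negbTE-> /negbTE-> /negbTE->].
by rewrite !mul0r.
Qed.
End CycleBoundary.

(** * Faces cut out by a wall *)

Section Faces.
Variable wall : rel torus.
Hypothesis wall_sym : symmetric wall.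

(** The squares [q] and [q - e2] share the side from [q] to [q + e1], while [q] and [q - e1] share
    the side from [q] to [q + e2]. *)
Let cross : rel torus := fun q q' =>
  (q' == q - e2) && ~~ wall q (q + e1) || (q' == q - e1) && ~~ wall q (q + e2).
Let link : rel torus := fun q q' => cross q q' || cross q' q.

(** A face is named by the representative square of its component. Any other square names the empty
    set, so sums over faces can run over all squares. *)
Definition face q := fingraph.root link q.

Lemma face_eq q q' : link q q' -> face q = face q'.
Proof.
move=> l; apply/eqP; rewrite root_connect ?connect1 //.
by apply: sym_connect_sym => x y; rewrite /link orbC.
Qed.

Definition in_face f q : bool := face q == f.

Lemma bd_face f x y : ~~ wall x y -> bd (in_face f) x y = 0.
Proof.
have step e e' a b : (e == e1) && (e' == e2) || (e == e2) && (e' == e1) ->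
    ~~ wall a b -> (b == a + e) * (in_face f a + in_face f (a - e')) = 0.
  move=> ee nw; case: eqP => [bE|_]; last by rewrite mul0r.
  rewrite mul1r; apply/bool_add_eq0; rewrite /in_face (@face_eq a (a - e')) //.
  rewrite /link /cross; case/orP: ee => /andP[/eqP ee /eqP ee']; subst e e';
  by rewrite -bE nw eqxx ?orbT.
by move=> nw; rewrite /bd !step ?addr0 ?eqxx ?orbT // wall_sym.
Qed.

Lemma face_const S q : (forall x y, ~~ wall x y -> bd S x y = 0) -> S (face q) = S q.
Proof.
move=> Sw.
have cr a b : cross a b -> S a = S b.
  case/orP=> /andP[/eqP-> /Sw]; rewrite ?bd_e1 ?bd_e2 => /bool_add_eq0; by [].
have /connectP[p] : connect link q (face q) by exact: connect_root.
elim: p q => [|b p IH] q /=; first by move=> _ ->.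
case/andP=> l pp e; rewrite -/(face q) in e.
have qb := face_eq l; rewrite qb in e *; rewrite IH //.
by case/orP: l => /cr.
Qed.

Lemma bd_sum (I : finType) (s : I -> bool) (A : I -> torus -> bool) x y :
  bd (fun q => \sum_i s i * A i q) x y = \sum_i s i * bd (A i) x y.
Proof.
rewrite /bd -!big_split /= !big_distrr -!big_split /=; apply: eq_bigr => i _.
rewrite !mulrDr; do !rewrite !(mulrCA _ (s i)); by [].
Qed.

(** A set whose boundary lies in the wall is a union of faces ([face_const]), and [bd] is linear. *)
Lemma bd_in_face_sum S x y : (forall x y, ~~ wall x y -> bd S x y = 0) ->
  bd S x y = \sum_f S f * bd (in_face f) x y.
Proof.
move=> Sw; rewrite -bd_sum.
have E q : S q = \sum_f S f * in_face f q.
  under eq_bigr do rewrite mulrC /in_face eq_sym.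
  by rewrite sum_pred1_mul face_const.
by rewrite /bd -!E.
Qed.

(** The faces together form the whole torus, a closed surface with empty boundary. *)
Lemma sum_bd_in_face x y : \sum_f bd (in_face f) x y = 0.
Proof.
have bd1 a b : bd (fun=> true) a b = 0 by rewrite /bd !bool_addrr !mulr0 !addr0.
by rewrite -[RHS](bd1 x y) bd_in_face_sum //; apply: eq_bigr => f _; rewrite mul1r.
Qed.

Lemma card_bd_in_face x y : (#|[set f | bd (in_face f) x y]| <= 2)%N.
Proof.
have two a b (Q : pred torus) : (forall f, Q f -> (in_face f a + in_face f b)%R) ->
    (#|[set f | Q f]| <= 2)%N.
  move=> Qab; apply: leq_trans (_ : #|[set face a; face b]| <= 2)%N; last first.
    by rewrite cards2; case: (_ != _).
  apply/subset_leq_card/subsetP=> f; rewrite !inE => /Qab; rewrite /in_face.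
  by rewrite !(eq_sym f); apply: bool_add_or.
case: (boolP (adjacent x y)) => [/adjacentP[||z ->|z ->]|na].
- by apply: two => f; rewrite bd_e1; exact.
- by apply: two => f; rewrite bd_e2; exact.
- by apply: two => f; rewrite bd_sym bd_e1; exact.
- by apply: two => f; rewrite bd_sym bd_e2; exact.
rewrite (_ : [set _ | _] = set0) ?cards0 //; apply/setP=> f; rewrite !inE.
move: na; rewrite /adjacent /bd !negb_or => /and4P[/negbTE-> /negbTE-> /negbTE-> /negbTE->].
by rewrite !mul0r.
Qed.
End Faces.

(** * Lattice walks as mod 2 chains *)

Definition step x y := (x == y) || adjacent x y.

(** Edges are counted mod 2 in both orientations, so a stationary step contributes two equal terms
    and vanishes. *)
Definition walk_chain (w : nat -> torus) (k : nat) x y : bool :=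
  \sum_(i < k) ((x == w i) * (y == w i.+1) + (x == w i.+1) * (y == w i)).

Lemma walk_chain_sym w k x y : walk_chain w k x y = walk_chain w k y x.
Proof.
by apply: eq_bigr => i _; rewrite addrC; congr (_ + _); rewrite mulrC.
Qed.

Lemma walk_chain_node w k x : \sum_y walk_chain w k x y = (x == w 0%N) + (x == w k).
Proof.
rewrite exchange_big /=.
have E i : \sum_y ((x == w i) * (y == w i.+1) + (x == w i.+1) * (y == w i))
   = (x == w i) + (x == w i.+1).
  rewrite big_split /=; congr (_ + _).
    by under eq_bigr do rewrite mulrC; rewrite (sum_pred1_mul _ (fun=> x == w i)).
  by under eq_bigr do rewrite mulrC; rewrite (sum_pred1_mul _ (fun=> x == w i.+1)).
under eq_bigr do rewrite E.
elim: k => [|k IH]; first by rewrite big_ord0 bool_addrr.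
rewrite big_ord_recr /= IH.
by case: (_ == _); case: (_ == _); case: (_ == _).
Qed.

Lemma walk_chain_exists w k x y : walk_chain w k x y ->
  exists2 i, (i < k)%N & (x = w i /\ y = w i.+1) \/ (x = w i.+1 /\ y = w i).
Proof.
have [|no] := boolP [exists i : 'I_k, ((x == w i) && (y == w i.+1)) ||
   ((x == w i.+1) && (y == w i))].
  case/existsP=> i /orP[] /andP[/eqP-> /eqP->] _; exists i => //; by [left|right].
rewrite /walk_chain big1 // => i _; move: no; rewrite negb_exists => /forallP/(_ i).
by case: (_ == _); case: (_ == _); case: (_ == _); case: (_ == _).
Qed.

Lemma walk_chain_adjacent w k x y : (forall i, (i < k)%N -> step (w i) (w i.+1)) ->
  walk_chain w k x y -> adjacent x y.
Proof.
move=> st wxy; case: (eqVneq x y) => [xy|].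
  move: wxy; rewrite /walk_chain xy big1 // => i _.
  by rewrite [X in _ + X]mulrC bool_addrr.
case/walk_chain_exists: wxy => i /st /orP[/eqP-> |st' ].
  by case=> -[-> ->]; rewrite eqxx.
by case=> -[-> ->] // _; rewrite adjacent_sym.
Qed.
End Torus.

(** * Lattice paths joining blocks *)

Definition off_axes n (p : torus n) := (p.1 != 0) && (p.2 != 0).

Section TrunkBound.
Variables (n : nat) (V1 V2 : finType) (E : {set V1 * V2}).
Variables (ctr : V1 + V2 -> torus n) (B : V1 + V2 -> {set torus n}).
Variables (w : V1 * V2 -> nat -> torus n) (k : V1 * V2 -> nat).
Implicit Types (e f : V1 * V2) (v : V1 + V2) (x y p : torus n).

Hypothesis B_conn : forall v p, p \in B v -> exists (g : nat -> torus n) m,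
  [/\ g 0%N = ctr v, g m = p, forall i, (i <= m)%N -> g i \in B v &
      forall i, (i < m)%N -> step (g i) (g i.+1)].
Hypothesis B_off : forall v p, p \in B v -> off_axes p.
Hypothesis B_disj : forall v v' p, p \in B v -> p \in B v' -> v = v'.
Hypothesis w_start : forall e, e \in E -> w e 0%N \in B (inl e.1).
Hypothesis w_end : forall e, e \in E -> w e (k e) \in B (inr e.2).
Hypothesis w_adj : forall e i, e \in E -> (i < k e)%N -> adjacent (w e i) (w e i.+1).
Hypothesis w_inj : forall e i j, e \in E -> (i <= k e)%N -> (j <= k e)%N ->
  w e i = w e j -> i = j.
Hypothesis w_out : forall e i v, e \in E -> (0 < i < k e)%N -> w e i \notin B v.
Hypothesis w_off : forall e i, e \in E -> (i <= k e)%N -> off_axes (w e i).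
Hypothesis w_disj : forall e f i j, e \in E -> f \in E -> (0 < i < k e)%N ->
  (0 < j < k f)%N -> w e i = w f j -> e = f.

Lemma k_gt0 e : e \in E -> (0 < k e)%N.
Proof.
move=> eE; rewrite lt0n; apply/eqP=> k0; have := w_end eE; rewrite k0.
by move/B_disj/(_ (w_start eE)).
Qed.

Lemma block_index e i v : e \in E -> (i <= k e)%N -> w e i \in B v ->
  (i = 0%N /\ v = inl e.1) \/ (i = k e /\ v = inr e.2).
Proof.
move=> eE ik wB; case: (posnP i) => [i0|i0]; [left|right]; split=> //.
- by apply: B_disj wB _; rewrite i0 w_start.
- apply/eqP; rewrite eqn_leq ik leqNgt; apply: contraL wB => ik'.
  by apply: w_out; rewrite ?i0.
have ki : i = k e.
  apply/eqP; rewrite eqn_leq ik leqNgt; apply: contraL wB => ik'.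
  by apply: w_out; rewrite ?i0.
by apply: B_disj wB _; rewrite ki w_end.
Qed.

Lemma same_point e f i j : e \in E -> f \in E -> (i <= k e)%N -> (j <= k f)%N ->
  w e i = w f j -> [\/ e = f, [/\ i = 0%N, j = 0%N & e.1 = f.1] |
    [/\ i = k e, j = k f & e.2 = f.2]].
Proof.
move=> eE fE ik jk wij.
have [|ie] := boolP [exists v, w e i \in B v].
  case/existsP=> v wB; have := block_index eE ik wB.
  rewrite wij in wB; have := block_index fE jk wB.
  by case=> -[-> ->] [] [->] // [->]; [apply: Or32|apply: Or33].
have inner g l : g \in E -> (l <= k g)%N -> w g l = w e i -> (0 < l < k g)%N.
  move=> gE lk wg; rewrite lt0n ltn_neqAle lk andbT; apply/andP; split.
    apply: contra ie => /eqP l0; apply/existsP; exists (inl g.1).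
    by rewrite -wg l0 w_start.
  apply: contra ie => /eqP l0; apply/existsP; exists (inr g.2).
  by rewrite -wg l0 w_end.
apply: Or31; apply: (w_disj eE fE _ _ wij); apply: inner => //.
Qed.

(** Distinct paths meet only at a common end, with the same index counted from that end. A shared
    lattice edge would have to join the left ends to the right ends, so [e] and [f] would have the
    same endpoints. *)
Lemma shared_edge e f i j : e \in E -> f \in E -> (i < k e)%N -> (j < k f)%N ->
  (w e i = w f j /\ w e i.+1 = w f j.+1) \/ (w e i = w f j.+1 /\ w e i.+1 = w f j) ->
  e = f /\ i = j.
Proof.
move=> eE fE ik jk sh.
have ef : e = f.
  case: sh => -[h1 h2].
    case: (same_point eE fE (ltnW ik) (ltnW jk) h1) => // [[_ _ E1]|[]]; last by lia.
    case: (same_point eE fE ik jk h2) => // [[]|[_ _ E2]] //.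
    by case: e f E1 E2 {eE fE ik jk h1 h2} => [a b] [a' b'] /= -> ->.
  by case: (same_point eE fE (ltnW ik) jk h1) => // [[]|[]] //; lia.
subst f; split=> //; case: sh => -[h1 h2].
  by apply: w_inj h1 => //; exact: ltnW.
have := w_inj eE (ltnW ik) jk h1; have := w_inj eE ik (ltnW jk) h2; lia.
Qed.

Definition on_trunk e x y := [exists i : 'I_(k e),
  ((x == w e i) && (y == w e i.+1)) || ((x == w e i.+1) && (y == w e i))].

(** Lattice edges inside a block belong to the wall because the chains of [edge_chain] run through
    blocks. A face bordered by block edges only vanishes on every path and is not counted in
    [face_count]. *)
Definition wall x y := [exists v, (x \in B v) && (y \in B v)] ||
  [exists e in E, on_trunk e x y].

Lemma on_trunk_sym e x y : on_trunk e x y = on_trunk e y x.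
Proof.
by apply: eq_existsb => i; rewrite orbC; congr orb; rewrite andbC.
Qed.

Lemma wall_sym : symmetric wall.
Proof.
move=> x y; congr orb; first by apply: eq_existsb => v; rewrite andbC.
by apply: eq_existsb => e; rewrite on_trunk_sym.
Qed.

Lemma wallP x y : reflect ((exists2 v, x \in B v & y \in B v) \/
    (exists e i, [/\ e \in E, (i < k e)%N & (x = w e i /\ y = w e i.+1) \/
       (x = w e i.+1 /\ y = w e i)])) (wall x y).
Proof.
apply: (iffP orP) => [[/existsP[v /andP[xv yv]]|]|].
- by left; exists v.
- case/exists_inP=> e eE /existsP[i b]; right; exists e, i; split=> //.
  by case/orP: b => /andP[/eqP-> /eqP->]; [left|right].
case=> [[v xv yv]|[e [i [eE ik xy]]]]; [left|right].
  by apply/existsP; exists v; rewrite xv.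
apply/exists_inP; exists e => //; apply/existsP; exists (Ordinal ik) => /=.
by case: xy => -[-> ->]; rewrite !eqxx ?orbT.
Qed.

Let A q := in_face wall q.

(** At an interior point of a path the only wall edges are the two path edges, and a face boundary
    has even degree there. Hence a face has one well-defined value on each path, read off at its
    first lattice edge. *)
Lemma bd_trunk q e i : e \in E -> (i < k e)%N ->
  bd (A q) (w e i) (w e i.+1) = bd (A q) (w e 0%N) (w e 1%N).
Proof.
move=> eE; elim: i => // i IH ik; rewrite -IH ?(ltnW ik) //.
have node := bd_node (A q) (w e i.+1).
have ne : w e i != w e i.+2.
  by apply/eqP=> /(w_inj eE (ltnW (ltnW ik)) ik); lia.
move: node; rewrite (bigD1 (w e i)) //= (bigD1 (w e i.+2)) 1?eq_sym //= big1.
  by rewrite addr0 => /bool_add_eq0 <-; rewrite bd_sym.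
move=> y /andP[y1 y2]; apply: bd_face; first exact: wall_sym.
have out v : w e i.+1 \notin B v by apply: w_out.
apply/negP=> /wallP[[v xv]|[f [j [fE jk xy]]]]; first by rewrite (negPf (out v)) in xv.
case: xy => -[x_ y_].
  have [ef|[]|[]] := same_point eE fE (ltnW ik) (ltnW jk) x_; try lia.
  subst f; have ij := w_inj eE (ltnW ik) (ltnW jk) x_.
  by rewrite y_ -ij eqxx in y2.
have [ef|[]|[]] := same_point eE fE (ltnW ik) jk x_; try lia.
subst f; have ij := w_inj eE (ltnW ik) jk x_.
by case: ij => ij; rewrite y_ -ij eqxx in y1.
Qed.

(** This is [cut_sum] for the block of [v]: only wall edges leaving the block contribute, and [g]
    enumerates them by the graph edges at [v]. *)
Lemma cut_edges q v (Ev : {set V1 * V2}) (g : V1 * V2 -> torus n * torus n) :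
  {in Ev &, injective g} ->
  (forall e, e \in Ev -> (g e).1 \in B v /\ (g e).2 \notin B v) ->
  (forall x y, x \in B v -> y \notin B v -> wall x y -> (x, y) \in g @: Ev) ->
  \sum_(e in Ev) bd (A q) (g e).1 (g e).2 = 0.
Proof.
move=> g_inj gB gW.
rewrite -(big_imset (fun p : torus n * torus n => bd (A q) p.1 p.2)) //=.
rewrite -[RHS](cut_sum (B v) (bd_sym (A q)) (bd_diag (A q)) (bd_node (A q))).
rewrite pair_big_dep /= big_mkcond [RHS]big_mkcond /=.
apply: eq_bigr => -[x y] _ /=; case: imsetP => [[e eE xy]|no].
  by have [] := gB e eE; rewrite -xy /= => -> ->.
case: ifP => // /andP[xB yB]; apply/esym/bd_face; first exact: wall_sym.
by apply/negP=> /(gW _ _ xB yB)/imsetP.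
Qed.

Lemma even_face q : even_on E (fun e => bd (A q) (w e 0%N) (w e 1%N)).
Proof.
split=> a.
  have := @cut_edges q (inl a) [set e in E | e.1 == a] (fun e => (w e 0%N, w e 1%N)).
  under eq_bigl do rewrite inE; apply => [e f|e|x y xB yB /wallP[[v xv yv]|]].
  - rewrite !inE => /andP[eE _] /andP[fE _] [h0 h1].
    by case: (shared_edge eE fE (k_gt0 eE) (k_gt0 fE)); first by left.
  - rewrite inE => /andP[eE /eqP <-]; rewrite w_start //; split=> //.
    apply/negP=> /(block_index eE (k_gt0 eE)); by case=> -[].
  - by rewrite -(B_disj xB xv) (negPf yB) in yv *.
  case=> e [i [eE ik [] [x_ y_]]]; rewrite x_ in xB.
    case: (block_index eE (ltnW ik) xB) => -[]; last by lia.
    by move=> i0 [av]; apply/imsetP; exists e; rewrite ?inE ?eE ?av ?eqxx // x_ y_ i0.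
  by case: (block_index eE ik xB) => -[].
(* At a right vertex the lattice edge leaving the block is the last one of the path, taken
   backwards; [bd_trunk] gives it the value of the first one. *)
have := @cut_edges q (inr a) [set e in E | e.2 == a]
  (fun e => (w e (k e), w e (k e).-1)).
have sw e : e \in E ->
   bd (A q) (w e (k e)) (w e (k e).-1) = bd (A q) (w e 0%N) (w e 1%N).
  move=> eE; rewrite -(@bd_trunk q e (k e).-1) ?prednK ?k_gt0 //.
  exact: bd_sym.
under eq_bigl do rewrite inE.
under eq_bigr => e /andP[eE _] do rewrite sw //.
apply => [e f|e|x y xB yB /wallP[[v xv yv]|]].
- rewrite !inE => /andP[eE _] /andP[fE _] [h0 h1].
  have kE := k_gt0 eE; have kF := k_gt0 fE.
  have [|||] // := @shared_edge e f (k e).-1 (k f).-1 eE fE; try by lia.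
  by left; rewrite !prednK.
- rewrite inE => /andP[eE /eqP <-]; rewrite w_end //; split=> //.
  have kE := k_gt0 eE; apply/negP=> /(block_index eE (leq_pred _))[[_ //]|[ke _]].
  by move: kE ke; clear; lia.
- by rewrite -(B_disj xB xv) (negPf yB) in yv *.
case=> e [i [eE ik [] [x_ y_]]]; rewrite x_ in xB.
  case: (block_index eE (ltnW ik) xB) => -[] //; by lia.
case: (block_index eE ik xB) => -[] // ki [av].
apply/imsetP; exists e; rewrite ?inE ?eE ?av ?eqxx // x_ y_ ki.
by rewrite -ki.
Qed.

(** The chain runs from the centre of one block to the start of the path, along the path, and inside
    the other block to its centre. Only the path part can contain first lattice edges of paths, so
    evaluation there recovers [e]. *)
Lemma edge_chain e : e \in E -> exists c : torus n -> torus n -> bool,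
  [/\ forall x y, c x y = c y x,
      forall x y, c x y -> [&& adjacent x y, off_axes x & wall x y],
      forall x, \sum_y c x y = (x == ctr (inl e.1)) + (x == ctr (inr e.2)) &
      forall f, f \in E -> c (w f 0%N) (w f 1%N) = (e == f)].
Proof.
move=> eE.
have [g [m [g0 gm gB gs]]] := B_conn (w_start eE).
have [g' [m' [g0' gm' gB' gs']]] := B_conn (w_end eE).
have blockW v h l : (forall i, (i <= l)%N -> h i \in B v) ->
    forall x y, walk_chain h l x y -> x \in B v /\ y \in B v.
  move=> hB x y /walk_chain_exists[i il].
  by case=> -[-> ->]; split; apply: hB => //; exact: ltnW.
have block_good v h l : (forall i, (i <= l)%N -> h i \in B v) ->
    (forall i, (i < l)%N -> step (h i) (h i.+1)) ->
    forall x y, walk_chain h l x y -> [&& adjacent x y, off_axes x & wall x y].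
  move=> hB hs x y hxy; rewrite (walk_chain_adjacent hs hxy) /=.
  have [xv yv] := blockW _ _ _ hB _ _ hxy; rewrite (B_off xv) /=.
  by apply/wallP; left; exists v.
have block_first v h l : (forall i, (i <= l)%N -> h i \in B v) ->
    forall f, f \in E -> walk_chain h l (w f 0%N) (w f 1%N) = false.
  move=> hB f fE; apply/negP=> /(blockW _ _ _ hB)[h0 h1].
  have := block_index fE (k_gt0 fE) h1; rewrite -(B_disj (w_start fE) h0).
  by case=> -[].
exists (fun x y => walk_chain g m x y + walk_chain g' m' x y + walk_chain (w e) (k e) x y).
split=> [x y|x y|x|f fE].
- by congr (_ + _ + _); apply: walk_chain_sym.
- case: (boolP (walk_chain g m x y)) => [/(block_good _ _ _ gB gs)//|_].
  case: (boolP (walk_chain g' m' x y)) => [/(block_good _ _ _ gB' gs')//|_].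
  rewrite addr0 add0r => wxy; rewrite (walk_chain_adjacent _ wxy) /=; last first.
    by move=> i ik; rewrite /step w_adj ?orbT.
  have [i ik xy] := walk_chain_exists wxy; apply/andP; split.
    by case: xy => -[-> _]; apply: w_off => //; exact: ltnW.
  by apply/wallP; right; exists e, i.
- rewrite !big_split /= !walk_chain_node g0 gm g0' gm'.
  by case: (_ == _); case: (_ == _); case: (_ == _); case: (_ == _).
rewrite (block_first _ _ _ gB _ fE) (block_first _ _ _ gB' _ fE).
rewrite !add0r /walk_chain; case: eqP => [<-|ne].
  rewrite (bigD1 (Ordinal (k_gt0 eE))) //= !eqxx /= big1 => [|i i0].
    have := @w_inj e 0 1 eE (leq0n _) (k_gt0 eE).
    by case: eqP => [-> /(_ erefl)//|].
  apply/negbTE/negP=> h.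
  have sh : (w e 0%N = w e i /\ w e 1%N = w e i.+1) \/
      (w e 0%N = w e i.+1 /\ w e 1%N = w e i).
    by move: h; do 4 case: eqP => ?; auto.
  have [_ i0'] := shared_edge eE eE (k_gt0 eE) (ltn_ord i) sh.
  by case/eqP: i0; apply: val_inj.
rewrite big1 // => i _; apply/negbTE/negP=> h; apply: ne.
have sh : (w e i = w f 0%N /\ w e i.+1 = w f 1%N) \/ (w e i = w f 1%N /\ w e i.+1 = w f 0%N).
  by move: h; do 4 case: eqP => ?; auto.
by case: (shared_edge eE fE (ltn_ord i) (k_gt0 fE) sh).
Qed.

(** For the spanning hypothesis of [face_count], an even edge set [z] is lifted to the lattice cycle
    [C]. That cycle bounds a set [S] of squares and lies in the wall, so [S] splits into faces. *)
Lemma trunk_bound : (2 < #|V1| + #|V2|)%N -> (#|E| <= 2 * (#|V1| + #|V2|) - 4)%N.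
Proof.
apply: (face_count (D := fun q e => bd (A q) (w e 0%N) (w e 1%N))).
- by move=> e _; apply: card_bd_in_face.
- by move=> e _; apply: sum_bd_in_face.
- exact: even_face.
move=> z [ev1 ev2].
have /fin_all_exists[c cP] e : exists c : torus n -> torus n -> bool, e \in E ->
  [/\ forall x y, c x y = c y x,
      forall x y, c x y -> [&& adjacent x y, off_axes x & wall x y],
      forall x, \sum_y c x y = (x == ctr (inl e.1)) + (x == ctr (inr e.2)) &
      forall f, f \in E -> c (w f 0%N) (w f 1%N) = (e == f)].
  have [eE|] := boolP (e \in E); last by exists (fun _ _ => false).
  by have [c cP] := edge_chain eE; exists c.
pose C x y : bool := \sum_(e in E) z e * c e x y.
have C_supp x y : C x y -> [&& adjacent x y, off_axes x & wall x y].
  apply: contraTT => no; rewrite /C big1 // => e eE.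
  case: (boolP (c e x y)) => [|_]; last by rewrite mulr0.
  by have [_ h _ _] := cP e eE; move/h; rewrite (negPf no).
have [S CS] : exists S, forall x y, C x y = bd S x y.
  apply: cycle_boundary => [x y|x y /C_supp/and3P[]|x|x y /C_supp/and3P[]] //.
    by apply: eq_bigr => e eE; have [-> _ _ _] := cP e eE.
  rewrite exchange_big /=.
  (* Grouped by left and by right endpoints, the contributions at the block centres vanish because
     [z] is even. *)
  have z0 : \sum_(e in E) z e * (x == ctr (inl e.1)) +
            \sum_(e in E) z e * (x == ctr (inr e.2)) = 0.
    rewrite (partition_big (fun e => e.1) xpredT) //= big1 => [|a _].
      rewrite add0r (partition_big (fun e => e.2) xpredT) //= big1 // => a _.
      under eq_bigr => e /andP[_ /eqP ->] do [].
      by rewrite -big_distrl /= ev2 mul0r.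
    under eq_bigr => e /andP[_ /eqP ->] do [].
    by rewrite -big_distrl /= ev1 mul0r.
  rewrite -[RHS]z0 -big_split /=; apply: eq_bigr => e eE.
  by have [_ _ nd _] := cP e eE; rewrite -big_distrr /= nd mulrDr.
(* The coefficient of a face is its membership in [S]. On the first lattice edge of [f] only the
   chain of [f] contributes to [C]. *)
exists S => f fE.
rewrite -bd_in_face_sum; first last.
- by move=> x y; rewrite -CS => nw; apply: contraNF nw => /C_supp/and3P[].
rewrite -CS /C (bigD1 f) //= big1 => [|e /andP[eE ne]].
  by have [_ _ _ ->] := cP f fE; rewrite // eqxx mulr1 addr0.
by have [_ _ _ ->] := cP e eE; rewrite // (negPf ne) mulr0.
Qed.
End TrunkBound.

(** * Blocks and simple paths extracted from lattice walks *)

Section WalkBound.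
Variables (n : nat) (V1 V2 : finType) (E : {set V1 * V2}).
Variables (ctr : V1 + V2 -> torus n) (W : V1 * V2 -> nat -> torus n) (a : nat).
Implicit Types (e f : V1 * V2) (v : V1 + V2) (p : torus n).

Definition near_end e i v := match v with
  | inl x => (x == e.1) && (i <= a)%N
  | inr y => (y == e.2) && (2 * a <= i <= 3 * a)%N
  end.

Hypothesis W_start : forall e, e \in E -> W e 0%N = ctr (inl e.1).
Hypothesis W_end : forall e, e \in E -> W e (3 * a)%N = ctr (inr e.2).
Hypothesis W_step : forall e i, e \in E -> (i < 3 * a)%N -> step (W e i) (W e i.+1).
Hypothesis W_off : forall e i, e \in E -> (i <= 3 * a)%N -> off_axes (W e i).
Hypothesis W_ends : forall e f i j v v', e \in E -> f \in E ->
  near_end e i v -> near_end f j v' -> W e i = W f j -> v = v'.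
Hypothesis W_end_edge : forall e f i j v, e \in E -> f \in E ->
  near_end e i v -> (j <= 3 * a)%N -> W e i = W f j -> v = inl f.1 \/ v = inr f.2.
Hypothesis W_middle : forall e f i j, e \in E -> f \in E ->
  (a <= i <= 2 * a)%N -> (a <= j <= 2 * a)%N -> W e i = W f j -> e = f.

Definition block v : {set torus n} := [set p | [exists e in E,
  exists i : 'I_(3 * a).+1, near_end e i v && (W e i == p)]].

Lemma near_end_le e i v : near_end e i v -> (i <= 3 * a)%N.
Proof. by case: v => x /= /andP[_]; lia. Qed.

Lemma blockP v p :
  reflect (exists e i, [/\ e \in E, near_end e i v & W e i = p]) (p \in block v).
Proof.
rewrite inE; apply: (iffP exists_inP) => [[e eE /existsP[i /andP[ne /eqP Wp]]]|].
  by exists e, i.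
case=> e [i [eE ne Wp]]; exists e => //; apply/existsP.
by exists (Ordinal (near_end_le ne : (i < (3 * a).+1)%N)); rewrite ne Wp eqxx.
Qed.

Lemma step_sym (p q : torus n) : step p q -> step q p.
Proof. by rewrite /step eq_sym adjacent_sym. Qed.

Lemma block_conn v p : p \in block v -> exists (g : nat -> torus n) m,
  [/\ g 0%N = ctr v, g m = p, forall i, (i <= m)%N -> g i \in block v &
      forall i, (i < m)%N -> step (g i) (g i.+1)].
Proof.
case/blockP=> e [i [eE]]; case: v => [x|y] /= /andP[/eqP-> ia] Wp.
  exists (W e), i; split=> [||j ji|j ji] //; first exact: W_start.
    by apply/blockP; exists e, j; rewrite /= eqxx; split=> //; lia.
  by apply: W_step => //; lia.
exists (fun j => W e (3 * a - j)%N), (3 * a - i)%N; split=> [||j ji|j ji].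
- by rewrite subn0 W_end.
- by rewrite subKn //; lia.
- by apply/blockP; exists e, (3 * a - j)%N; rewrite /= eqxx; split=> //; lia.
apply: step_sym; have -> : (3 * a - j = (3 * a - j.+1).+1)%N by lia.
by apply: W_step => //; lia.
Qed.

Lemma block_disj v v' p : p \in block v -> p \in block v' -> v = v'.
Proof.
case/blockP=> e [i [eE ne <-]] /blockP[f [j [fE nf]]] /esym.
exact: W_ends.
Qed.

(** The walk is cut at [i1], its first visit to the right block, and at [i0], its last earlier visit
    to the left block; then loops are erased. *)
Lemma trunk_exists e : e \in E -> exists (w : nat -> torus n) k,
  [/\ w 0%N \in block (inl e.1), w k \in block (inr e.2),
      forall i, (i < k)%N -> adjacent (w i) (w i.+1),
      forall i j, (i <= k)%N -> (j <= k)%N -> w i = w j -> i = j &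
      (forall i, (i <= k)%N -> exists2 j, (j <= 3 * a)%N & w i = W e j) /\
      (forall i, (0 < i < k)%N -> (forall v, w i \notin block v) /\
         exists2 j, (a <= j <= 2 * a)%N & w i = W e j)].
Proof.
move=> eE.
have startB : W e 0%N \in block (inl e.1).
  by apply/blockP; exists e, 0%N; rewrite /= eqxx.
have endB : W e (3 * a)%N \in block (inr e.2).
  by apply/blockP; exists e, (3 * a)%N; rewrite /= eqxx; split=> //; lia.
have ex1 : exists i, W e i \in block (inr e.2) by exists (3 * a)%N.
case: (ex_minnP ex1) => i1 i1B i1min.
have i1a : (i1 <= 3 * a)%N by apply: i1min.
have ex0 : exists i, (i <= i1)%N && (W e i \in block (inl e.1)) by exists 0%N.
have bd0 i : (i <= i1)%N && (W e i \in block (inl e.1)) -> (i <= i1)%N by case/andP.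
case: (ex_maxnP ex0 bd0) => i0 /andP[i01 i0B] i0max.
have {}i01 : (i0 < i1)%N.
  rewrite ltn_neqAle i01 andbT; apply: contraTneq i1B => <-.
  by apply/negP=> /(block_disj i0B).
pose p := [seq W e j | j <- iota i0.+1 (i1 - i0)].
have pathp : path (@step n) (W e i0) p.
  apply/(pathP (W e i0)) => i; rewrite size_map size_iota => ii.
  rewrite /p (nth_map 0%N) ?size_iota // nth_iota //.
  have -> : nth (W e i0) (W e i0 :: p) i = W e (i0 + i)%N.
    case: i ii => [|i] ii /=; first by rewrite addn0.
    by rewrite (nth_map 0%N) ?size_iota ?nth_iota ?addSnnS //; exact: ltnW.
  by rewrite addSn; apply: W_step => //; lia.
have lastp : last (W e i0) p = W e i1.
  rewrite (last_nth (W e i0)) size_map size_iota.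
  have -> : (i1 - i0 = (i1 - i0.+1).+1)%N by lia.
  by rewrite /= (nth_map 0%N) ?size_iota ?nth_iota; try lia; congr (W e _); lia.
(* The loop-erased path still visits only points of the walk with index in [i0 .. i1]. *)
case/shortenP: pathp lastp => p' pathp' uniqp' subp' lastp'.
pose w i := nth (W e i0) (W e i0 :: p') i; exists w, (size p').
have wk : w (size p') = W e i1 by rewrite /w -lastp' (last_nth (W e i0)).
have winj i j : (i <= size p')%N -> (j <= size p')%N -> w i = w j -> i = j.
  by move=> ik jk /eqP; rewrite /w nth_uniq // => /eqP.
have wW i : (0 < i <= size p')%N -> exists2 j, (i0 < j <= i1)%N & w i = W e j.
  case: i => // i ik; have /subp'/mapP[j] : w i.+1 \in p' by apply: mem_nth.
  by rewrite mem_iota => jj ->; exists j => //; lia.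
split=> [||i ik|//|]; first by [].
- by rewrite wk.
- have : step (w i) (w i.+1) by have /(pathP (W e i0))/(_ i ik) := pathp'.
  by case/orP=> // /eqP/(winj _ _ (ltnW ik) ik); lia.
split=> i; first case: (posnP i) => [-> _|i0' ik].
- by exists i0 => //; lia.
- by have [|j jj ->] := wW i; [rewrite i0'|exists j => //; lia].
move=> /andP[i0' ik]; have [|j jj wj] := wW i; first by rewrite i0' ltnW.
have j_lt : (j < i1)%N.
  rewrite ltn_neqAle andbC; case/andP: jj => _ -> /=; apply/eqP=> j1.
  by have := winj i (size p') (ltnW ik) (leqnn _); rewrite wk wj j1 => /(_ erefl); lia.
(* By [W_end_edge] only the blocks of the two ends of [e] could be met; the choices of [i0] and [i1]
   exclude them. *)
have out v : w i \notin block v.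
  apply/negP=> wB; move: (wB) => /blockP[f [l [fE nf Wf]]].
  rewrite wj in Wf; have jl : (j <= 3 * a)%N by move: jj i1a; clear; lia.
  rewrite wj in wB.
  case: (W_end_edge fE eE nf jl Wf) => ve; subst v.
    by have := i0max j; rewrite wB andbT; move: jj; clear; lia.
  by have := i1min j wB; move: j_lt; clear; lia.
(* An index outside the middle third would put the point in an end block of [e]. *)
split=> //; exists j => //; rewrite wj in out; apply/andP; split.
  rewrite leqNgt; apply/negP=> ja; case/blockP: (out (inl e.1)).
  by exists e, j; rewrite /= eqxx; split=> //; lia.
rewrite leqNgt; apply/negP=> ja; case/blockP: (out (inr e.2)).
by exists e, j; rewrite /= eqxx; split=> //; lia.
Qed.

Lemma walk_bound : (2 < #|V1| + #|V2|)%N -> (#|E| <= 2 * (#|V1| + #|V2|) - 4)%N.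
Proof.
have /fin_all_exists[w /fin_all_exists[k wP]] e : exists (w : nat -> torus n) k, e \in E ->
  [/\ w 0%N \in block (inl e.1), w k \in block (inr e.2),
      forall i, (i < k)%N -> adjacent (w i) (w i.+1),
      forall i j, (i <= k)%N -> (j <= k)%N -> w i = w j -> i = j &
      (forall i, (i <= k)%N -> exists2 j, (j <= 3 * a)%N & w i = W e j) /\
      (forall i, (0 < i < k)%N -> (forall v, w i \notin block v) /\
         exists2 j, (a <= j <= 2 * a)%N & w i = W e j)].
  have [eE|] := boolP (e \in E); last by exists (fun=> 0), 0%N.
  by have [w [k wk]] := trunk_exists eE; exists w, k.
apply: (@trunk_bound n V1 V2 E ctr block w k).
- exact: block_conn.
- move=> v p /blockP[e [i [eE ne <-]]]; apply: W_off => //; exact: near_end_le ne.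
- exact: block_disj.
- by move=> e /wP[].
- by move=> e /wP[].
- by move=> e i /wP[_ _ h _ _]; apply: h.
- by move=> e i j /wP[_ _ _ h _]; apply: h.
- by move=> e i v /wP[_ _ _ _ [_ h]] /h[].
- by move=> e i eE; have [_ _ _ _ [h _]] := wP e eE; case/h=> j ja ->; apply: W_off.
move=> e f i j eE fE ik jk wij.
have [_ _ _ _ [_ /(_ i ik)[_ [i' i'a ei]]]] := wP e eE.
have [_ _ _ _ [_ /(_ j jk)[_ [j' j'a fj]]]] := wP f fE.
by apply: W_middle i'a j'a _; rewrite -?ei -?fj.
Qed.
End WalkBound.

(** * Transfer from natural number coordinates to the torus *)

Lemma torus_natr_inj n i j : (i < n.+3)%N -> (j < n.+3)%N ->
  i%:R = j%:R :> 'I_n.+3 -> i = j.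
Proof.
by move=> ii jj /(congr1 val); rewrite !Zp_nat /= !modn_small.
Qed.

Lemma torus_natr_eq0 n i : (0 < i < n.+3)%N -> (i%:R == 0 :> 'I_n.+3) = false.
Proof.
by move=> /andP[i0 ii]; apply/eqP=> /(@torus_natr_inj n i 0 ii (ltn0Sn _)) i0'; rewrite i0' in i0.
Qed.

Definition nat_step (p q : nat * nat) : bool :=
  (p.1 == q.1) && (p.2 <= q.2.+1)%N && (q.2 <= p.2.+1)%N ||
  (p.2 == q.2) && (p.1 <= q.1.+1)%N && (q.1 <= p.1.+1)%N.

Lemma nat_step_torus n (p q : nat * nat) : nat_step p q ->
  step ((p.1%:R, p.2%:R) : torus n) (q.1%:R, q.2%:R).
Proof.
have succ1 i j : (i.+1%:R, j%:R) = ((i%:R, j%:R) : torus n) + @e1 n.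
  by congr pair; rewrite /= ?addr0 // mulrSr.
have succ2 i j : (i%:R, j.+1%:R) = ((i%:R, j%:R) : torus n) + @e2 n.
  by congr pair; rewrite /= ?addr0 // mulrSr.
case: p q => [i j] [i' j'] /orP[] /= /andP[/andP[/eqP <- h1] h2].
  have [-> | [-> | ->]] : j' = j \/ (j' = j.+1 \/ j = j'.+1) by lia.
  - by rewrite /step eqxx.
  - by rewrite /step /adjacent succ2 eqxx !orbT.
  - by rewrite /step /adjacent succ2 eqxx !orbT.
have [-> | [-> | ->]] : i' = i \/ (i' = i.+1 \/ i = i'.+1) by lia.
- by rewrite /step eqxx.
- by rewrite /step /adjacent succ1 eqxx !orbT.
- by rewrite /step /adjacent succ1 eqxx !orbT.
Qed.

Lemma nat_walk_bound (n : nat) (V1 V2 : finType) (E : {set V1 * V2})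
    (ctr : V1 + V2 -> nat * nat) (W : V1 * V2 -> nat -> nat * nat) (a : nat) :
  (forall e, e \in E -> W e 0%N = ctr (inl e.1)) ->
  (forall e, e \in E -> W e (3 * a)%N = ctr (inr e.2)) ->
  (forall e i, e \in E -> (i < 3 * a)%N -> nat_step (W e i) (W e i.+1)) ->
  (forall e i, e \in E -> (i <= 3 * a)%N ->
     (0 < (W e i).1 < n.+3)%N && (0 < (W e i).2 < n.+3)%N) ->
  (forall e f i j v v', e \in E -> f \in E ->
     near_end a e i v -> near_end a f j v' -> W e i = W f j -> v = v') ->
  (forall e f i j v, e \in E -> f \in E ->
     near_end a e i v -> (j <= 3 * a)%N -> W e i = W f j ->
     v = inl f.1 \/ v = inr f.2) ->
  (forall e f i j, e \in E -> f \in E ->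
     (a <= i <= 2 * a)%N -> (a <= j <= 2 * a)%N -> W e i = W f j -> e = f) ->
  (2 < #|V1| + #|V2|)%N -> (#|E| <= 2 * (#|V1| + #|V2|) - 4)%N.
Proof.
move=> W_start W_end W_step W_off W_ends W_end_edge W_middle.
pose emb (p : nat * nat) : torus n := (p.1%:R, p.2%:R).
have W_emb e f i j : e \in E -> f \in E -> (i <= 3 * a)%N -> (j <= 3 * a)%N ->
    emb (W e i) = emb (W f j) -> W e i = W f j.
  move=> eE fE ia ja [].
  have /andP[/andP[_ h1] /andP[_ h2]] := W_off e i eE ia.
  have /andP[/andP[_ h3] /andP[_ h4]] := W_off f j fE ja.
  move=> /(torus_natr_inj h1 h3) E1 /(torus_natr_inj h2 h4).
  by case: (W e i) (W f j) E1 => ? ? [? ?] /= -> ->.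
apply: (@walk_bound n V1 V2 E (emb \o ctr) (fun e i => emb (W e i)) a).
- by move=> e eE; rewrite W_start.
- by move=> e eE; rewrite W_end.
- by move=> e i eE ia; apply/nat_step_torus/W_step.
- move=> e i eE ia; have /andP[h1 h2] := W_off e i eE ia.
  by rewrite /off_axes /= !torus_natr_eq0.
- move=> e f i j v v' eE fE ne nf /W_emb WW; apply: (W_ends e f i j v v' eE fE ne nf).
  by apply: WW => //; apply: near_end_le; [exact: ne | exact: nf].
- move=> e f i j v eE fE ne ja /W_emb WW; apply: (W_end_edge e f i j v eE fE ne ja).
  by apply: WW => //; apply: near_end_le ne.
- move=> e f i j eE fE ia ja /W_emb WW; apply: (W_middle e f i j eE fE ia ja).
  by apply: WW => //; lia.
Qed.

End Grid.

Module Drawing.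
Import Lra all_boot zify_ssreflect Rcomplements Compactness Grid.
Set Implicit Arguments.
Unset Strict Implicit.
Unset Printing Implicit Defensive.
Delimit Scope R_scope with R.
Local Open Scope nat_scope.

(** * From continuous arcs to lattice paths *)

Lemma fin_pos_lower_bound (T : finType) (d : T -> R) :
  (forall x, (0 < d x)%R) -> exists2 r : R, (0 < r)%R & forall x, (r <= d x)%R.
Proof.
move=> d0.
have [r r0 rd] : exists2 r : R, (0 < r)%R & forall x, x \in enum T -> (r <= d x)%R.
  elim: (enum T) => [|x s [r r0 rs]]; first by exists 1%R => //; lra.
  exists (Rmin r (d x)) => [|y]; first exact: Rmin_pos.
  rewrite inE => /predU1P[->|/rs]; first exact: Rmin_r.
  exact/Rle_trans/Rmin_l.
by exists r => // x; apply: rd; rewrite mem_enum.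
Qed.

Lemma fin_uniform_pos (T : finType) (P : T -> R -> Prop) :
  (forall x, exists2 r : R, (0 < r)%R & P x r) ->
  (forall x r r', (0 < r')%R -> (r' <= r)%R -> P x r -> P x r') ->
  exists2 r : R, (0 < r)%R & forall x, P x r.
Proof.
move=> ex mono.
have /fin_all_exists[d dP] x : exists r : R, (0 < r)%R /\ P x r.
  by have [r] := ex x; exists r.
have [|r r0 rd] := @fin_pos_lower_bound _ d; first by move=> x; case: (dP x).
by exists r => // x; have [_ Pd] := dP x; apply: mono Pd.
Qed.

Lemma continuity_pt_delta f x eps : continuity_pt f x -> (0 < eps)%R ->
  exists2 r, (0 < r)%R & forall y, (Rabs (y - x) < r)%R -> (Rabs (f y - f x) < eps)%R.
Proof.
move=> cf e0; have [r [r0 rP]] := cf eps e0; exists r => // y yx.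
case: (Req_dec x y) => [->|xy]; first by rewrite Rminus_diag Rabs_R0.
by apply: rP; split=> //; split.
Qed.

Definition dist1 (p q : R * R) : R := (Rabs (fst p - fst q) + Rabs (snd p - snd q))%R.

Lemma Rabs_quad a b a' b' :
  (Rabs (a - b) <= Rabs (a' - a) + Rabs (a' - b') + Rabs (b' - b))%R.
Proof. by split_Rabs; lra. Qed.

Definition continuous_on (a b : R) (f : R -> R * R) : Prop :=
  forall s, (a <= s <= b)%R ->
    continuity_pt (fun s => fst (f s)) s /\ continuity_pt (fun s => snd (f s)) s.

(** Disjoint compact arcs have positive distance: a local lower bound around each pair of parameters
    becomes uniform by compactness of the rectangle. *)
Lemma arcs_separation (f g : R -> R * R) a b c d :
  continuous_on a b f -> continuous_on c d g ->
  (forall s t, (a <= s <= b)%R -> (c <= t <= d)%R -> f s <> g t) ->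
  exists2 r, (0 < r)%R & forall s t, (a <= s <= b)%R -> (c <= t <= d)%R ->
    (r <= dist1 (f s) (g t))%R.
Proof.
move=> cf cg fg.
have loc u v : exists r : posreal, (a <= u <= b)%R -> (c <= v <= d)%R ->
    forall x y, (Rabs (x - u) < r)%R -> (Rabs (y - v) < r)%R ->
    (r <= dist1 (f x) (g y))%R.
  case: (classic ((a <= u <= b)%R /\ (c <= v <= d)%R)) => [[uab vcd]|no]; last first.
    by exists (mkposreal 1 Rlt_0_1) => ? ?; case: no.
  have D0 : (0 < dist1 (f u) (g v))%R.
    have := fg u v uab vcd; case: (f u) (g v) => x1 x2 [y1 y2] ne; rewrite /dist1 /=.
    case: (Req_dec x1 y1) => [xy1|xy1]; last first.
      have := Rabs_pos_lt (x1 - y1)%R; have := Rabs_pos (x2 - y2); lra.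
    case: (Req_dec x2 y2) => [xy2|xy2]; first by case: ne; rewrite xy1 xy2.
    by have := Rabs_pos_lt (x2 - y2)%R; have := Rabs_pos (x1 - y1); lra.
  (* Four coordinates each move by less than an eighth of the distance, so more than half of it
     remains. *)
  have e0 : (0 < dist1 (f u) (g v) / 8)%R by lra.
  have [cf1 cf2] := cf u uab; have [cg1 cg2] := cg v vcd.
  have [r1 r10 h1] := continuity_pt_delta cf1 e0.
  have [r2 r20 h2] := continuity_pt_delta cf2 e0.
  have [r3 r30 h3] := continuity_pt_delta cg1 e0.
  have [r4 r40 h4] := continuity_pt_delta cg2 e0.
  pose r := Rmin (Rmin (Rmin r1 r2) (Rmin r3 r4)) (dist1 (f u) (g v) / 2).
  have r0 : (0 < r)%R by rewrite /r; repeat apply: Rmin_pos; lra.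
  exists (mkposreal r r0) => _ _ x y /= xu yv.
  have lr : (r <= r1 /\ r <= r2 /\ r <= r3 /\ r <= r4 /\ r <= dist1 (f u) (g v) / 2)%R.
    rewrite /r; have := Rmin_l (Rmin (Rmin r1 r2) (Rmin r3 r4)) (dist1 (f u) (g v) / 2).
    have := Rmin_r (Rmin (Rmin r1 r2) (Rmin r3 r4)) (dist1 (f u) (g v) / 2).
    have := Rmin_l (Rmin r1 r2) (Rmin r3 r4); have := Rmin_r (Rmin r1 r2) (Rmin r3 r4).
    have := Rmin_l r1 r2; have := Rmin_r r1 r2; have := Rmin_l r3 r4; have := Rmin_r r3 r4.
    by lra.
  have := h1 x; have := h2 x; have := h3 y; have := h4 y.
  move=> /(_ ltac:(lra)) k4 /(_ ltac:(lra)) k3 /(_ ltac:(lra)) k2 /(_ ltac:(lra)) k1.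
  have := Rabs_quad (fst (f u)) (fst (g v)) (fst (f x)) (fst (g y)).
  have := Rabs_quad (snd (f u)) (snd (g v)) (snd (f x)) (snd (g y)).
  by move: lr k1 k2 k3 k4; rewrite /dist1; lra.
pose delta u v := proj1_sig (constructive_indefinite_description _ (loc u v)).
have deltaP u v := proj2_sig (constructive_indefinite_description _ (loc u v)).
have [r rP] := compactness_value_2d a b c d delta.
exists r => [|s t sab tcd]; first exact: cond_pos.
(* [compactness_value_2d] provides its nearby pair only under a double negation, hence the proof by
   contradiction. *)
apply: Rnot_lt_le => lt; apply: (rP s t sab tcd) => -[u [v [uab [vcd [su [tv ru]]]]]].
have := deltaP u v uab vcd s t su tv; rewrite -/(delta u v); lra.
Qed.

Definition nat_floor (r : R) : nat := Z.to_nat (Int_part r).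

Lemma nat_floorP r : (0 <= r)%R -> (INR (nat_floor r) <= r < INR (nat_floor r) + 1)%R.
Proof.
move=> r0; have [h1 h2] := base_Int_part r.
have z0 : (0 <= Int_part r)%Z by suff : (-1 < Int_part r)%Z by [lia]; apply: lt_IZR; lra.
rewrite /nat_floor INR_IZR_INZ Z2Nat.id //; lra.
Qed.

Lemma nat_floor_close r r' : (0 <= r)%R -> (0 <= r')%R -> (Rabs (r - r') < 1)%R ->
  nat_floor r <= (nat_floor r').+1.
Proof.
move=> r0 r0' rr; have h1 := nat_floorP r0; have h2 := nat_floorP r0'.
have : (INR (nat_floor r) < INR (nat_floor r').+2)%R.
  by rewrite !S_INR; move: rr; split_Rabs; lra.
by move/INR_lt; lia.
Qed.

Lemma nat_floor_eq r r' : (0 <= r)%R -> (0 <= r')%R -> nat_floor r = nat_floor r' ->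
  (Rabs (r - r') < 1)%R.
Proof.
move=> r0 r0' rr; have h1 := nat_floorP r0; have := nat_floorP r0'; rewrite -rr.
by split_Rabs; lra.
Qed.

(** * Sampling the arcs of a drawing on a fine grid *)

Section ArcsBound.
Variables (V1 V2 : finType) (E : {set V1 * V2}).
Variables (pos : V1 + V2 -> R * R) (arc : V1 * V2 -> R -> R * R).
Implicit Types (e f : V1 * V2) (v : V1 + V2) (s t : R).

Hypothesis pos_inj : injective pos.
Hypothesis arc_cont : forall e, e \in E -> continuous_on 0 1 (arc e).
Hypothesis arc_box : forall e t, e \in E -> (0 <= t <= 1)%R ->
  (1/4 < fst (arc e t) < 3/4)%R /\ (1/4 < snd (arc e t) < 3/4)%R.
Hypothesis arc_inj : forall e s t, e \in E -> (0 <= s <= 1)%R -> (0 <= t <= 1)%R ->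
  arc e s = arc e t -> s = t.
Hypothesis arc_start : forall e, e \in E -> arc e 0%R = pos (inl e.1).
Hypothesis arc_end : forall e, e \in E -> arc e 1%R = pos (inr e.2).
Hypothesis arc_avoid : forall e t v, e \in E -> (0 < t < 1)%R -> arc e t <> pos v.
Hypothesis arc_cross : forall e f s t, e \in E -> f \in E -> e <> f ->
  (0 < s < 1)%R -> (0 <= t <= 1)%R -> arc e s <> arc f t.

Definition third (q : 'I_3) t : Prop := (INR q / 3 <= t <= (INR q + 1) / 3)%R.

Definition third_of_end v : 'I_3 := if v is inl _ then ord0 else ord_max.

Definition end_of e v : bool := match v with inl x => x == e.1 | inr y => y == e.2 end.

Lemma third_01 (q : 'I_3) t : third q t -> (0 <= t <= 1)%R.
Proof. by case: q => -[|[|[|//]]] i; rewrite /third /=; lra. Qed.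

Lemma end_cases e v s : e \in E -> end_of e v -> third (third_of_end v) s ->
  arc e s = pos v \/ (0 < s < 1)%R.
Proof.
move=> eE; case: v => [x|y] /= /eqP-> []; rewrite /= => h1 h2.
  case: (Req_dec s 0) => [->|]; [left; exact: arc_start | right; lra].
case: (Req_dec s 1) => [->|]; [left; exact: arc_end | right; lra].
Qed.

(** Different arcs can meet only at a common vertex, which is excluded by [v <> v']; on a single arc
    the first and last thirds are disjoint by injectivity. *)
Lemma ends_disjoint e f v v' s t : e \in E -> f \in E -> end_of e v -> end_of f v' ->
  v <> v' -> third (third_of_end v) s -> third (third_of_end v') t -> arc e s <> arc f t.
Proof.
move=> eE fE ev fv vv' st tt st_eq.
have s01 := third_01 st; have t01 := third_01 tt.
case: (end_cases eE ev st) (end_cases fE fv tt) => [es|s_int] [ft|t_int].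
- by apply/vv'/pos_inj; rewrite -es -ft.
- by apply: (@arc_avoid f t v fE t_int); rewrite -es.
- by apply: (@arc_avoid e s v' eE s_int); rewrite -ft.
case: (eqVneq e f) => [ef|/eqP ef]; last exact: (arc_cross eE fE ef s_int t01).
subst f; have ss := arc_inj eE s01 t01 st_eq; subst t.
case: v v' ev fv vv' st tt {s_int t_int s01 t01 st_eq} => [x|x] [y|y] /= /eqP-> /eqP->;
  rewrite /third //=; lra.
Qed.

Lemma end_edge_disjoint e f v s t : e \in E -> f \in E -> end_of e v ->
  ~~ end_of f v -> third (third_of_end v) s -> (0 <= t <= 1)%R -> arc e s <> arc f t.
Proof.
move=> eE fE ev nfv st t01 st_eq.
have ef : e <> f by move=> ef; rewrite -ef ev in nfv.
case: (end_cases eE ev st) => [es|s_int]; last exact: (arc_cross eE fE ef s_int t01).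
case: (Req_dec t 0) => [t0|t0].
  move: st_eq nfv; rewrite es t0 arc_start // => /pos_inj->; by rewrite /= eqxx.
case: (Req_dec t 1) => [t1|t1].
  move: st_eq nfv; rewrite es t1 arc_end // => /pos_inj->; by rewrite /= eqxx.
by apply: (@arc_avoid f t v fE); [lra | rewrite -es].
Qed.

(** The disjointness of a pair of thirds is a premise under the constant, so the finitely many
    disjoint pairs share one separation. *)
Lemma thirds_separation : exists2 r, (0 < r)%R &
  forall e f (q q' : 'I_3), e \in E -> f \in E ->
    (forall s t, third q s -> third q' t -> arc e s <> arc f t) ->
    forall s t, third q s -> third q' t -> (r <= dist1 (arc e s) (arc f t))%R.
Proof.
pose P (x : (V1 * V2) * (V1 * V2) * ('I_3 * 'I_3)) r :=
  x.1.1 \in E -> x.1.2 \in E ->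
    (forall s t, third x.2.1 s -> third x.2.2 t -> arc x.1.1 s <> arc x.1.2 t) ->
    forall s t, third x.2.1 s -> third x.2.2 t ->
    (r <= dist1 (arc x.1.1 s) (arc x.1.2 t))%R.
have [||r r0 rP] := @fin_uniform_pos _ P.
- case=> [[e f] [q q']]; rewrite /P /=.
  case: (classic (e \in E /\ f \in E /\
     forall s t, third q s -> third q' t -> arc e s <> arc f t)) => [[eE [fE ef]]|no].
    have ce (p : 'I_3) g : g \in E -> continuous_on (INR p / 3) ((INR p + 1) / 3) (arc g).
      by move=> gE s sp; apply: arc_cont => //; apply: third_01 sp.
    have [r r0 rP] := arcs_separation (ce q e eE) (ce q' f fE) ef.
    by exists r.
  by exists 1%R => [|eE fE ef]; [lra | case: no].
- move=> x r r' r0' rr h xE xE' xd s t st tt; have := h xE xE' xd s t st tt; lra.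
by exists r => // e f q q'; apply: (rP ((e, f), (q, q'))).
Qed.

Lemma arcs_uniform eps : (0 < eps)%R -> exists2 r, (0 < r)%R &
  forall e s t, e \in E -> (0 <= s <= 1)%R -> (0 <= t <= 1)%R -> (Rabs (s - t) < r)%R ->
    (Rabs (fst (arc e s) - fst (arc e t)) < eps)%R /\
    (Rabs (snd (arc e s) - snd (arc e t)) < eps)%R.
Proof.
move=> e0; pose P e r := e \in E -> forall s t, (0 <= s <= 1)%R -> (0 <= t <= 1)%R ->
    (Rabs (s - t) < r)%R ->
    (Rabs (fst (arc e s) - fst (arc e t)) < eps)%R /\
    (Rabs (snd (arc e s) - snd (arc e t)) < eps)%R.
have [e|e r r' r0 rr h eE s t s01 t01 st|r r0 rP] := @fin_uniform_pos _ P.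
- case: (boolP (e \in E)) => [eE|ne]; last by exists 1%R; [lra | rewrite /P (negPf ne)].
  have c1 s : (0 <= s <= 1)%R -> continuity_pt (fun s => fst (arc e s)) s.
    by case/(arc_cont eE).
  have c2 s : (0 <= s <= 1)%R -> continuity_pt (fun s => snd (arc e s)) s.
    by case/(arc_cont eE).
  have [d1 h1] := Heine_cor2 c1 (mkposreal eps e0).
  have [d2 h2] := Heine_cor2 c2 (mkposreal eps e0).
  exists (Rmin d1 d2) => [|_ s t s01 t01 st]; first by apply: Rmin_pos; apply: cond_pos.
  have := Rmin_l d1 d2; have := Rmin_r d1 d2 => m1 m2.
  by split; [apply: h1 | apply: h2] => //; lra.
- by apply: h => //; lra.
by exists r => // e s t eE; apply: rP.
Qed.

Lemma arcs_bound : 2 < #|V1| + #|V2| -> #|E| <= 2 * (#|V1| + #|V2|) - 4.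
Proof.
have [d d0 sep] := thirds_separation.
(* The grid has mesh 1/M. M > 4 keeps the scaled arcs, drawn in the box (1/4, 3/4), at coordinates
   above 1, and 6/M < d makes samples at the same lattice point too close to lie on separated
   thirds. *)
have [n nP] := INR_archimed 1 (4 + 6 / d) ltac:(lra).
pose M := INR n.+3.
have d6 : (0 < 6 / d)%R by apply: Rdiv_lt_0_compat; lra.
have M4 : (4 < M)%R by rewrite /M !S_INR; lra.
have Md : (6 / M < d)%R.
  have : (6 / d < M)%R by rewrite /M !S_INR; lra.
  by move=> h; apply/Rlt_div_l; [lra|]; move/Rlt_div_l: h; lra.
have Mi : (0 < 1 / M)%R by apply: Rdiv_lt_0_compat; lra.
have [r r0 unif] := arcs_uniform Mi.
(* Each third gets K samples, so consecutive parameters differ by 1/(3K) < r and each coordinate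
   moves by less than one mesh width. *)
have [K' K'P] := INR_archimed r 1 ltac:(lra).
pose K := K'.+1.
have K0 : (1 <= INR K)%R by rewrite S_INR; have := pos_INR K'; lra.
have Kr : (1 < INR K * r)%R by rewrite S_INR; lra.
pose tm i := (INR i / (3 * INR K))%R.
have tm_third (q : 'I_3) i : q * K <= i <= q.+1 * K -> third q (tm i).
  case/andP=> /leP/le_INR h1 /leP/le_INR h2; move: h1 h2; rewrite !mult_INR S_INR => h1 h2.
  have E1 : (tm i * (3 * INR K) = INR i)%R by rewrite /tm; field; lra.
  have E2 x : (x / 3 * (3 * INR K) = x * INR K)%R by field.
  by split; apply: (Rmult_le_reg_r (3 * INR K)); rewrite ?E1 ?E2; lra.
have tm01 i : i <= 3 * K -> (0 <= tm i <= 1)%R.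
  move=> /leP/le_INR; rewrite mult_INR [INR 3]/= => h.
  by have := pos_INR i; split; rewrite /tm; [apply: Rdiv_le_0_compat | apply/Rle_div_l]; lra.
have tm_step i : (Rabs (tm i.+1 - tm i) < r)%R.
  have -> : (tm i.+1 - tm i = / (3 * INR K))%R by rewrite /tm S_INR; field; lra.
  have i0 : (0 < / (3 * INR K))%R by apply: Rinv_0_lt_compat; lra.
  rewrite Rabs_pos_eq; last lra.
  by rewrite -[(/ _)%R]Rmult_1_l; apply/Rlt_div_l; lra.
pose X e i := nat_floor (M * fst (arc e (tm i))).
pose Y e i := nat_floor (M * snd (arc e (tm i))).
(* The first coordinate advances at even [m] and the second at odd [m], so each lattice step changes
   only one coordinate. A sample step takes two walk steps, and a third has length 2K. *)
pose W e m := (X e (uphalf m), Y e m./2).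
pose ctr v := (nat_floor (M * fst (pos v)), nat_floor (M * snd (pos v))).
have half_le m : m <= 3 * (2 * K) -> m./2 <= 3 * K /\ uphalf m <= 3 * K.
  by move=> mK; rewrite uphalf_half; have := odd_double_half m; case: (odd m); lia.
have box e i : e \in E -> i <= 3 * K ->
   (1 < M * fst (arc e (tm i)) < M)%R /\ (1 < M * snd (arc e (tm i)) < M)%R.
  move=> eE iK; have [[h1 h2] [h3 h4]] := arc_box eE (tm01 i iK).
  by split; split; nra.
have scale x y : (Rabs (M * x - M * y) < 1)%R <-> (Rabs (x - y) < 1 / M)%R.
  rewrite -Rmult_minus_distr_l Rabs_mult (Rabs_pos_eq M); last lra.
  split=> h; first by apply/Rlt_div_r; lra.
  by move/Rlt_div_r: h; lra.
have stepXY e i : e \in E -> i < 3 * K ->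
    [/\ X e i <= (X e i.+1).+1, X e i.+1 <= (X e i).+1,
        Y e i <= (Y e i.+1).+1 & Y e i.+1 <= (Y e i).+1].
  move=> eE iK; have [b1 b2] := box e i eE (ltnW iK); have [b3 b4] := box e i.+1 eE iK.
  have [u1 u2] := unif e _ _ eE (tm01 _ iK) (tm01 _ (ltnW iK)) (tm_step i).
  move/scale: u1 => u1; move/scale: u2 => u2.
  by split; apply: nat_floor_close; try lra; rewrite Rabs_minus_sym.
have near_half e m : e \in E -> m <= 3 * (2 * K) ->
    (Rabs (fst (arc e (tm (uphalf m))) - fst (arc e (tm m./2))) < 1 / M)%R.
  move=> eE mK; have [h1 h2] := half_le m mK; move: h2; rewrite uphalf_half.
  case: (odd m) => h2; last by rewrite add0n Rminus_diag Rabs_R0; lra.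
  by have [] := unif e _ _ eE (tm01 _ h2) (tm01 _ h1) (tm_step _).
have close e f i j : e \in E -> f \in E -> i <= 3 * (2 * K) -> j <= 3 * (2 * K) ->
    W e i = W f j -> (dist1 (arc e (tm i./2)) (arc f (tm j./2)) < d)%R.
  move=> eE fE iK jK [].
  have [i1 i2] := half_le i iK; have [j1 j2] := half_le j jK.
  have [bi1 _] := box e _ eE i2; have [_ bi2] := box e _ eE i1.
  have [bj1 _] := box f _ fE j2; have [_ bj2] := box f _ fE j1.
  move=> /nat_floor_eq => /(_ ltac:(lra) ltac:(lra))/scale hx.
  move=> /nat_floor_eq => /(_ ltac:(lra) ltac:(lra))/scale hy.
  have hi := near_half e i eE iK; have hj := near_half f j fE jK.
  (* The first coordinates differ by at most three errors of size 1/M, two of them from the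
     half-step offset, and the second ones by one such error. *)
  apply: Rlt_trans Md; have -> : (6 / M = 6 * (1 / M))%R by field; lra.
  have := Rabs_quad (fst (arc e (tm i./2))) (fst (arc f (tm j./2)))
    (fst (arc e (tm (uphalf i)))) (fst (arc f (tm (uphalf j)))).
  by move: hx hy hi hj; rewrite /dist1; lra.
have near_third e m v : near_end (2 * K) e m v -> end_of e v /\
    third (third_of_end v) (tm m./2).
  case: v => [x|y] /= /andP[-> mK]; split=> //; apply: tm_third => /=;
  by have := odd_double_half m; case: (odd m); lia.
have any_third m : m <= 3 * (2 * K) -> exists q : 'I_3, third q (tm m./2).
  move=> /half_le[mK _]; case: (leqP m./2 K) => m1.
    by exists ord0; apply: tm_third => /=; lia.
  case: (leqP m./2 (2 * K)) => m2.
    by exists (@Ordinal 3 1 isT); apply: tm_third => /=; lia.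
  by exists ord_max; apply: tm_third => /=; lia.
apply: (@nat_walk_bound n V1 V2 E ctr W (2 * K)).
- by move=> e eE; rewrite /W /X /Y /ctr /tm /= /Rdiv Rmult_0_l arc_start.
- move=> e eE; have -> : 3 * (2 * K) = (3 * K).*2 by lia.
  rewrite /W uphalf_double doubleK /X /Y /ctr.
  have -> : tm (3 * K) = 1%R by rewrite /tm mult_INR [INR 3]/=; field; lra.
  by rewrite arc_end.
- move=> e i eE iK; rewrite /nat_step /W /=.
  have := odd_double_half i; rewrite uphalf_half; case: (odd i) => /= ii.
    have [|h1 h2 h3 h4] := stepXY e i./2 eE; first lia.
    by rewrite eqxx /=; apply/orP; left; rewrite h3.
  have [|h1 h2 h3 h4] := stepXY e i./2 eE; first lia.
  by apply/orP; right; rewrite eqxx h1.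
- move=> e i eE /half_le[h1 h2]; rewrite /W /=.
  have [b1 _] := box e _ eE h2; have [_ b2] := box e _ eE h1.
  have fl x : (1 < x < M)%R -> 0 < nat_floor x < n.+3.
    move=> x1M; have [] := @nat_floorP x ltac:(lra); move=> f1 f2.
    apply/andP; split; apply/ltP/INR_lt; first by rewrite [INR 0]/=; lra.
    by rewrite -/M; lra.
  by rewrite !fl.
- move=> e f i j v v' eE fE ne nf WW.
  have dd := close _ _ _ _ eE fE (near_end_le ne) (near_end_le nf) WW.
  have [ev ti] := near_third _ _ _ ne; have [fv tj] := near_third _ _ _ nf.
  apply: NNPP => vv; have := sep e f _ _ eE fE _ _ _ ti tj.
  move=> /(_ (fun s t => ends_disjoint eE fE ev fv vv)); lra.
- move=> e f i j v eE fE ne jK WW.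
  have dd := close _ _ _ _ eE fE (near_end_le ne) jK WW.
  have [ev ti] := near_third _ _ _ ne; have [q tj] := any_third j jK.
  have : end_of f v.
    apply/negPn/negP=> nfv; have := sep e f _ _ eE fE _ _ _ ti tj.
    move=> h; suff : (d <= dist1 (arc e (tm i./2)) (arc f (tm j./2)))%R by lra.
    apply: h => s t st tt; apply: (end_edge_disjoint eE fE ev nfv st).
    exact: third_01 tt.
  by case: v {ne ev ti} => x /= /eqP->; [left|right].
- move=> e f i j eE fE ia ja WW.
  have dd := close e f i j eE fE ltac:(lia) ltac:(lia) WW.
  apply: NNPP => ef.
  have mid m : 2 * K <= m <= 2 * (2 * K) -> third (@Ordinal 3 1 isT) (tm m./2).
    by move=> mK; apply: tm_third => /=; have := odd_double_half m; case: (odd m); lia.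
  suff : (d <= dist1 (arc e (tm i./2)) (arc f (tm j./2)))%R by lra.
  apply: sep (mid i ia) (mid j ja) => // s t st tt.
  apply: (arc_cross eE fE ef); last exact: third_01 tt.
  by move: st; rewrite /third /=; lra.
Qed.
End ArcsBound.

(** * Plane drawings *)

(** A homeomorphism of the line onto an open interval inside (1/4, 3/4). It puts drawings into the
    box needed for sampling and into disjoint cells side by side. *)
Definition squash (x : R) : R := (1 / 2 + atan x / 8)%R.

Lemma squash_bound x : (1 / 4 < squash x < 3 / 4)%R.
Proof. by have := atan_bound x; have := PI_4; rewrite /squash; lra. Qed.

Lemma squash_inj x y : squash x = squash y -> x = y.
Proof.
move=> h; rewrite -(tan_atan x) -(tan_atan y); congr tan; move: h.
by rewrite /squash; lra.
Qed.

Definition cell_map (k : nat) (p : R * R) : R * R :=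
  (INR k + squash (fst p), squash (snd p))%R.

Lemma cell_map_inj k k' p p' : cell_map k p = cell_map k' p' -> k = k' /\ p = p'.
Proof.
case: p p' => [x y] [x' y'] [/= h /squash_inj->].
have bx := squash_bound x; have bx' := squash_bound x'.
have kk : k = k'.
  have : (INR k < INR k'.+1)%R by rewrite S_INR; lra.
  have : (INR k' < INR k.+1)%R by rewrite S_INR; lra.
  by move=> /INR_lt h1 /INR_lt h2; lia.
by split=> //; congr pair; apply: squash_inj; move: h; rewrite kk; lra.
Qed.

Lemma squash_continuous f t : continuity_pt f t -> continuity_pt (fun s => squash (f s)) t.
Proof.
move=> cf; apply: (continuity_pt_comp f squash) => //.
apply: continuity_pt_plus; first by apply: continuity_pt_const.
rewrite /Rdiv; apply: continuity_pt_mult; last by apply: continuity_pt_const.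
exact/derivable_continuous_pt/derivable_pt_atan.
Qed.

(** Points in different cells never coincide, and within one cell [emb] is injective, so every
    collision would already occur in the drawing of [G]. *)
Lemma cell_map_drawing (H G : graph) (cell : vtx H -> nat) (emb : vtx H -> vtx G) pos arc :
  (forall u v, cell u = cell v -> emb u = emb v -> u = v) ->
  (forall u v, adj H u v -> cell u = cell v /\ adj G (emb u) (emb v)) ->
  plane_drawing G pos arc ->
  plane_drawing H (fun u => cell_map (cell u) (pos (emb u)))
    (fun u v t => cell_map (cell u) (arc (emb u) (emb v) t)).
Proof.
move=> inj hom [pos_inj [edge cross]]; split; last split.
- by move=> u v /cell_map_inj[cuv /pos_inj]; apply: inj.
- move=> u v uv; have [cuv /edge[cont [ainj [a0 [a1 [rev avoid]]]]]] := hom u v uv.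
  split; last split; last split; last split; last split.
  + move=> t t01; have [c1 c2] := cont t t01; split; last exact: squash_continuous.
    apply: continuity_pt_plus; first by apply: continuity_pt_const.
    exact: squash_continuous.
  + by move=> s t s01 t01 /cell_map_inj[_]; apply: ainj.
  + by rewrite a0.
  + by rewrite a1 cuv.
  + by move=> t t01; rewrite rev // cuv.
  + by move=> t w t01 /cell_map_inj[_]; apply: avoid.
move=> u v u' v' uv uv' ne ne' s t s01 t01 /cell_map_inj[cc].
have [cuv auv] := hom u v uv; have [cuv' auv'] := hom u' v' uv'.
apply: cross => // -[e1 e2].
  by apply: ne; split; apply: inj => //; rewrite -cuv -cuv'.
by apply: ne'; split; apply: inj => //; rewrite ?cuv' -?cuv -?cuv'.
Qed.

Lemma planar_copies (H G : graph) (cell : vtx H -> nat) (emb : vtx H -> vtx G) :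
  (forall u v, cell u = cell v -> emb u = emb v -> u = v) ->
  (forall u v, adj H u v -> cell u = cell v /\ adj G (emb u) (emb v)) ->
  planar G -> planar H.
Proof.
move=> inj hom [pos [arc dr]]; do 2 eexists; exact: cell_map_drawing inj hom dr.
Qed.

Lemma planar_bipartite_bound (G : graph) (V1 V2 : finType) (E : {set V1 * V2})
    (f1 : V1 -> vtx G) (f2 : V2 -> vtx G) :
  injective f1 -> injective f2 -> (forall a b, f1 a <> f2 b) ->
  (forall e, e \in E -> adj G (f1 e.1) (f2 e.2)) -> planar G ->
  2 < #|V1| + #|V2| -> #|E| <= 2 * (#|V1| + #|V2|) - 4.
Proof.
move=> inj1 inj2 inj12 hom [pos0 [arc0 dr0]].
(* Redrawing inside cell 0 places the arcs in the box required by [arcs_bound]. *)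
pose pos u := cell_map 0 (pos0 u); pose arc u v t := cell_map 0 (arc0 u v t).
have [pos_inj [edge cross]] : plane_drawing G pos arc.
  by apply: (@cell_map_drawing G G (fun=> 0) id).
pose vpos (v : V1 + V2) := match v with inl a => pos (f1 a) | inr b => pos (f2 b) end.
pose earc (e : V1 * V2) := arc (f1 e.1) (f2 e.2).
have edgeE e (eE : e \in E) := edge _ _ (hom e eE).
apply: (@arcs_bound V1 V2 E vpos earc).
- move=> [a|b] [a'|b'] /pos_inj.
  + by move/inj1->.
  + by move/inj12.
  + by move/esym/inj12.
  + by move/inj2->.
- by move=> e eE s s01; have [cont _] := edgeE e eE; apply: cont.
- move=> e t eE t01; rewrite /earc /arc /cell_map /=.
  by split; [rewrite Rplus_0_l|]; apply: squash_bound.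
- by move=> e s t eE s01 t01; have [_ [ainj _]] := edgeE e eE; apply: ainj.
- by move=> e eE; have [_ [_ [a0 _]]] := edgeE e eE.
- by move=> e eE; have [_ [_ [_ [a1 _]]]] := edgeE e eE.
- move=> e t v eE t01; have [_ [_ [_ [_ [_ avoid]]]]] := edgeE e eE.
  by case: v => ?; apply: avoid.
move=> e f s t eE fE ef s01 t01; apply: cross s01 t01; try exact: hom.
  by case=> /inj1 e1 /inj2 e2; apply: ef; case: e f e1 e2 {eE fE} => ? ? [? ?] /= -> ->.
by case=> /inj12.
Qed.

(** One decomposition guarantees a least one, so the [epsilon] in [thickness] picks a genuine
    minimum. *)
Lemma thickness_spec G k : decomposable G k -> is_thickness G (thickness G).
Proof.
move=> dk; apply: epsilon_spec; elim/ltn_ind: k dk => k IH dk.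
case: (classic (exists2 j, j < k & decomposable G j)) => [[j jk dj]|no].
  exact: IH dj.
exists k; split=> // j dj; apply/leP; rewrite leqNgt; apply/negP=> jk.
by apply: no; exists j.
Qed.

(** * Decomposition of the complete bipartite graph into stars *)

Section Star.
Variables m n : nat.

Definition star_pos (v : fin m + fin n) : R * R :=
  match v with
  | inl i => (INR (proj1_sig i), 0%R)
  | inr j => (INR (proj1_sig j), 1%R)
  end.

Definition segment (u v : fin m + fin n) (t : R) : R * R :=
  ((1 - t) * fst (star_pos u) + t * fst (star_pos v),
   (1 - t) * snd (star_pos u) + t * snd (star_pos v))%R.

Definition star_colour (u v : fin m + fin n) : nat :=
  match u, v with
  | inl i, _ => proj1_sig i
  | inr _, inl i => proj1_sig i
  | inr _, inr _ => 0
  end.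

Lemma fin_eq k (x y : fin k) : proj1_sig x = proj1_sig y -> x = y.
Proof.
case: x y => [x px] [y py] /= xy; subst y; congr exist; exact: proof_irrelevance.
Qed.

Lemma star_pos_inj u v : star_pos u = star_pos v -> u = v.
Proof.
case: u v => [i|j] [i'|j'] [] /INR_eq h; try (by move=> ?; lra).
  by congr (inl _); apply: fin_eq.
by congr (inr _); apply: fin_eq.
Qed.

Lemma star_planar i :
  planar (Graph (fin m + fin n) (fun u v => part2 u <> part2 v /\ star_colour u v = i)).
Proof.
exists star_pos, segment; split; last split.
- exact: star_pos_inj.
- move=> u v /= [uv _]; split; last split; last split; last split; last split.
  + by move=> t _; split; rewrite /segment /=; apply: derivable_continuous_pt; reg.
  + move=> s t _ _; case: u v uv => [a|b] [a'|b'] //= _ []; lra.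
  + by case: u {uv} => a; rewrite /segment /=; congr pair; lra.
  + by case: v {uv} => a; rewrite /segment /=; congr pair; lra.
  + by move=> t _; rewrite /segment; congr pair; lra.
  + move=> t w t01; case: u v uv w => [a|b] [a'|b'] //= _ [c|c] []; lra.
(* In either orientation a point of the star with centre i is determined by its leaf j and its
   height r. Equal points above the centre have equal r > 0, hence equal j. *)
have norm u v s : part2 u <> part2 v -> star_colour u v = i -> exists j r,
    [/\ u = inr j \/ v = inr j,
        segment u v s = (INR i + r * (INR (proj1_sig j) - INR i), r)%R,
        forall a, u = inl a \/ v = inl a -> proj1_sig a = i &
        (0 < s < 1)%R -> (0 < r)%R].
  case: u v => [a|b] [a'|b'] //= _ <-.
    exists b', s; rewrite /segment /=; split; [by right| by congr pair; lra | | lra].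
    by move=> c [[->]|].
  exists b, (1 - s)%R; rewrite /segment /=; split; [by left| by congr pair; lra | | lra].
  by move=> c [|[->]].
move=> u v u' v' /= [uv cuv] [uv' cuv'] ne ne' s t s01 _.
have [j [r [uvj -> uvi /(_ s01) r0]]] := norm u v s uv cuv.
have [j' [r' [uvj' -> uvi' _]]] := norm u' v' t uv' cuv'.
case=> h rr; subst r'.
have jj : j = j'.
  apply/fin_eq/INR_eq; apply: (Rmult_eq_reg_l r); lra.
subst j'; case: u v uv uvj uvi ne ne' {cuv} => [a|b] [a'|b'] //= _ uvj uvi ne ne';
case: u' v' uv' uvj' uvi' ne ne' {cuv'} => [c|d] [c'|d'] //= _ uvj' uvi' ne ne'.
- apply: ne; split; first by congr (inl _); apply: fin_eq; rewrite uvi ?uvi'; auto.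
  by case: uvj uvj' => // -> [] // ->.
- apply: ne'; split; first by congr (inl _); apply: fin_eq; rewrite uvi ?uvi'; auto.
  by case: uvj uvj' => // -> [] // ->.
- apply: ne'; split; last by congr (inl _); apply: fin_eq; rewrite uvi ?uvi'; auto.
  by case: uvj uvj' => // -> [] // ->.
- apply: ne; split; last by congr (inl _); apply: fin_eq; rewrite uvi ?uvi'; auto.
  by case: uvj uvj' => // -> [] // ->.
Qed.

(** Provides the decomposition that [thickness_spec] asks for, so that the thickness of the complete
    bipartite graph is attained. *)
Lemma K2part_decomposable : decomposable (K2part m n) m.
Proof.
exists star_colour; split; last by move=> i _; exact: star_planar.
by move=> [a|b] [a'|b'] //= _; split=> //; [exact: (proj2_sig a) | exact: (proj2_sig a')].
Qed.
End Star.

(** * Upper bound from the two matchings of the hexagon *)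

Section Upper.
Variables l m n k : nat.
Hypotheses (lm : l <= m) (mn : m <= n).
Let V := vtx (kron (K3part l m n) K2).

Definition fin_widen a b (ab : a <= b) (x : fin a) : fin b :=
  exist _ (proj1_sig x) (Nat.lt_le_trans _ _ _ (proj2_sig x) (elimT leP ab)).

(* The six bipartite pieces of the product form the hexagon
   X0 Y1 Z0 X1 Y0 Z1; flipping [s] switches between its two perfect matchings,
   and [hexagon_cell] is the edge of the matching to which a vertex belongs. *)
Definition hexagon_cell (s : bool) (u : V) : nat :=
  match fst u, xorb (snd u) s with
  | inl (inl _), false | inl (inr _), true => 0
  | inl (inr _), false | inr _, true => 1
  | inr _, false | inl (inl _), true => 2
  end.

(** X goes to the side of size m and Z to the side of size n. Y takes the side opposite to its
    partner: size n when matched with X, size m when matched with Z. *)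
Definition hexagon_emb (s : bool) (u : V) : fin m + fin n :=
  match fst u with
  | inl (inl x) => inl (fin_widen lm x)
  | inl (inr y) => if xorb (snd u) s then inr (fin_widen mn y) else inl y
  | inr z => inr z
  end.

Lemma hexagon_inj s u v : hexagon_cell s u = hexagon_cell s v ->
  hexagon_emb s u = hexagon_emb s v -> u = v.
Proof.
case: u v => [[[x|y]|z] b] [[[x'|y']|z'] b']; rewrite /hexagon_cell /hexagon_emb /=;
case: s; case: b; case: b' => //= _ [] e //;
by [rewrite e | move/fin_eq: e => -> | congr (inl _, _); apply: fin_eq].
Qed.

(** Adjacent vertices lie in consecutive pieces of the hexagon; if the first matching does not join
    these pieces, the second one does. *)
Lemma hexagon_adj u v : adj (kron (K3part l m n) K2) u v ->
  let s := hexagon_cell false u != hexagon_cell false v in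
  hexagon_cell s u = hexagon_cell s v /\
  adj (K2part m n) (hexagon_emb s u) (hexagon_emb s v).
Proof.
case: u v => [[[x|y]|z] b] [[[x'|y']|z'] b'] [] //=;
by case: b; case: b'.
Qed.

Lemma kron_decomposable :
  decomposable (K2part m n) k -> decomposable (kron (K3part l m n) K2) (2 * k).
Proof.
move=> [c [cP cplanar]].
pose side (u v : V) := hexagon_cell false u != hexagon_cell false v.
(* Colours below [k] serve the first matching and colours from [k] on the second. *)
pose col (u v : V) := (if side u v then k else 0) +
  c (hexagon_emb (side u v) u) (hexagon_emb (side u v) v).
have side_sym u v : side u v = side v u by rewrite /side eq_sym.
exists col; split=> [u v uv|i ik].
  have [_ /cP[/ltP ck cs]] := hexagon_adj uv.
  split; last by rewrite /col -(side_sym u) cs.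
  by apply/ltP; rewrite /col /side; move: ck; case: ifP; lia.
pose s := k <= i.
have jk : i - (if s then k else 0) < k by rewrite /s; move/ltP: ik; case: ifP; lia.
apply: (@planar_copies (Graph V _) (Graph (fin m + fin n) _)
  (hexagon_cell s) (hexagon_emb s) _ _ (cplanar _ (elimT ltP jk))).
  exact: hexagon_inj.
move=> u v /= [uv coluv].
have [cell_uv /[dup] emb_uv /cP[/ltP ck _]] := hexagon_adj uv.
have ss : side u v = s.
  by move: coluv ck; rewrite /col /s -/(side u v); case: (side u v); lia.
rewrite -/(side u v) ss in cell_uv emb_uv ck *; split=> //; split=> //.
by rewrite -coluv /col ss; case: (s); lia.
Qed.
End Upper.

(** * Lower bound by counting edges *)

Section Lower.
Variables l m n : nat.

Definition ord_fin k (i : 'I_k) : fin k := exist _ (i : nat) (elimT ltP (ltn_ord i)).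

Definition tripart : finType := (('I_l + 'I_m) + 'I_n)%type.

Definition tripart_vtx (x : tripart) : vtx (K3part l m n) :=
  match x with
  | inl (inl i) => inl (inl (ord_fin i))
  | inl (inr i) => inl (inr (ord_fin i))
  | inr i => inr (ord_fin i)
  end.

Lemma tripart_vtx_inj : injective tripart_vtx.
Proof.
by move=> [[i|i]|i] [[j|j]|j] // [] /val_inj->.
Qed.

Definition tripart_edges : {set tripart * tripart} :=
  [set e | part3 (tripart_vtx e.1) != part3 (tripart_vtx e.2)].

Lemma card_tripart_edges : #|tripart_edges| = 2 * (l * m + l * n + m * n).
Proof.
rewrite -sum1_card big_mkcond /=.
under eq_bigr do rewrite inE.
rewrite -(pair_bigA _ (fun x y : tripart =>
  if part3 (tripart_vtx x) != part3 (tripart_vtx y) then 1 else 0)) /=.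
by rewrite !big_sumType /= !sum_nat_const !big_sumType /= !sum_nat_const !card_ord; lia.
Qed.

(** Each edge of the product is read from layer [false] to layer [true], so the edges correspond to
    the ordered pairs in [tripart_edges]. Each colour class is planar bipartite on N = 2(l+m+n)
    vertices, and 2N - 4 = 4(l+m+n) - 4. *)
Lemma kron_decomposable_bound k : 1 <= l -> 1 <= m -> 1 <= n ->
  decomposable (kron (K3part l m n) K2) k ->
  2 * (l * m + l * n + m * n) <= k * (4 * (l + m + n) - 4).
Proof.
move=> l1 m1 n1 [c [cP cplanar]]; rewrite -card_tripart_edges.
pose E i := [set e in tripart_edges |
  c (tripart_vtx e.1, false) (tripart_vtx e.2, true) == i].
have adjE (e : tripart * tripart) : e \in tripart_edges ->
   adj (kron (K3part l m n) K2) (tripart_vtx e.1, false) (tripart_vtx e.2, true).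
  by rewrite inE => /eqP.
have card_tri : #|{: tripart}| = l + m + n by rewrite !card_sum !card_ord.
have E_bound i : i < k -> #|E i| <= 4 * (l + m + n) - 4.
  move=> ik; apply: leq_trans (_ : _ <= 2 * (#|tripart| + #|tripart|) - 4) _; last first.
    by rewrite card_tri; lia.
  have pl := cplanar i (elimT ltP ik); set G := Graph _ _ in pl.
  apply: (@planar_bipartite_bound G tripart tripart (E i)
    (fun x => (tripart_vtx x, false)) (fun x => (tripart_vtx x, true)) _ _ _ _ pl) => //.
  - by move=> x y [/tripart_vtx_inj].
  - by move=> x y [/tripart_vtx_inj].
  - by move=> e; rewrite inE => /andP[/adjE ? /eqP].
  - by rewrite card_tri; lia.
have cover : tripart_edges \subset \bigcup_(i < k) E i.
  apply/subsetP=> e eE; have [/ltP ck _] := cP _ _ (adjE e eE).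
  by apply/bigcupP; exists (Ordinal ck) => //; rewrite inE eE /=.
apply: leq_trans (subset_leq_card cover) _.
apply: leq_trans (_ : _ <= \sum_(i < k) #|E i|) _.
  elim/big_rec2: _ => [|i x y _ h]; first by rewrite cards0.
  by apply: leq_trans (leq_card_setU _ _) _; rewrite leq_add2l.
rewrite -[k in k * _]card_ord -sum_nat_const; apply: leq_sum => i _.
exact: E_bound.
Qed.
End Lower.

Lemma kron_thickness_bounds l m n :
  1 <= l -> l <= m -> m <= n ->
  l * m + l * n + m * n <= thickness (kron (K3part l m n) K2) * (2 * (l + m + n) - 2) /\
  thickness (kron (K3part l m n) K2) <= 2 * thickness (K2part m n).
Proof.
move=> l1 lm mn.
have [dec _] := thickness_spec (@K2part_decomposable m n).
have [deck min] := thickness_spec (kron_decomposable lm mn dec).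
split; last exact/leP/min/(kron_decomposable lm mn dec).
by have := kron_decomposable_bound l1 (leq_trans l1 lm)
  (leq_trans l1 (leq_trans lm mn)) deck; nia.
Qed.
End Drawing.

Theorem theorem4p1 (l m n : nat) :
  (1 <= l)%nat -> (l <= m)%nat -> (m <= n)%nat ->
  ((l*m + l*n + m*n) + (2*(l+m+n) - 2) - 1) / (2*(l+m+n) - 2)
     <= thickness (kron (K3part l m n) K2)
  /\ thickness (kron (K3part l m n) K2) <= 2 * thickness (K2part m n).
Proof.
  intros l1 lm mn.
  destruct (Drawing.kron_thickness_bounds
    (ssrbool.introT ssrnat.leP l1) (ssrbool.introT ssrnat.leP lm)
    (ssrbool.introT ssrnat.leP mn)) as [lower upper].
  split; [|exact (ssrbool.elimT ssrnat.leP upper)].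
  assert (count : l*m + l*n + m*n
    <= thickness (kron (K3part l m n) K2) * (2*(l+m+n) - 2))
    by exact (ssrbool.elimT ssrnat.leP lower).
  (* With a the numerator, d the denominator and t the thickness, the ceiling is (a + d - 1)/d in
     natural numbers. It is at most t once a + d - 1 < d(t + 1), which follows from a <= td as d >
     0. *)
  apply Nat.lt_succ_r, Nat.Div0.div_lt_upper_bound.
  rewrite Nat.mul_succ_r, Nat.mul_comm.
  lia.
Qed.
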